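(* Let $n\ge1$ and let $\lambda$ be a dominant integral weight of $\mathfrak{sp}_{2n}$, identified with the partition $(\lambda_1\ge\dots\ge\lambda_n\ge0)$. The elements $X^a_T=\prod_{j=1}^{\lambda_1}X^a_{T_{1,j},\dots,T_{\mu_j,j}}$, $T\in\mathrm{SyST}_\lambda$, form a basis of $\mathbb C[\mathrm{Sp}\mathcal F^a_{2n}]_\lambda$.
   Context: Let $\bar i:=2n+1-i$, $\mathcal N=\{1<\dots<n<\bar n<\dots<\bar1\}$, $W=\mathbb C^{2n}$ with basis $w_1,\dots,w_{2n}$ indexed by $\mathcal N$ and symplectic form $\langle w_i,w_{\bar i}\rangle=1=-\langle w_{\bar i},w_i\rangle$, other basis pairings $0$. For $1\le k\le n$ let $\mathrm{pr}^{(k)}_{1,3}:W\to W$ kill coordinates $k+1,\dots,2n-k$ and $\mathrm{pr}_k$ kill the $k$-th coordinate. The complete symplectic PBW degenerate flag variety $\mathrm{Sp}\mathcal F^a_{2n}$ is the projective variety of tuples $(U_k)_{k=1}^n$, $U_k\subset W$, $\dim U_k=k$, with $\mathrm{pr}^{(k)}_{1,3}(U_k)$ isotropic and $\mathrm{pr}_{k+1}U_k\subset U_{k+1}$, embedded in $\prod_{k=1}^n\mathbb P(\bigwedge^k\mathbb C^{2n})$ by Plücker embeddings, with Plücker coordinates $X^a_{j_1,\dots,j_k}=(w_{j_1}\wedge\dots\wedge w_{j_k})^*$ (antisymmetric in the indices). $\mathbb C[\mathrm{Sp}\mathcal F^a_{2n}]$ is the multi-homogeneous coordinate ring, and for $\lambda=\sum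 m_k\omega_k$ (partition $\lambda_i=m_i+\dots+m_n$) $\mathbb C[\mathrm{Sp}\mathcal F^a_{2n}]_\lambda$ is the component spanned by products of Plücker coordinates containing exactly $m_k$ coordinates of size $k$ for each $k$ (isomorphic to $(V^a_\lambda)^*$, the dual of the PBW degenerate module). $\mu_j$ is the length of column $j$ of the Young diagram $Y_\lambda$ (English convention). $\mathrm{SyST}_\lambda$ is the set of symplectic PBW-semistandard tableaux: fillings $T_{i,j}\in\mathcal N$ of $Y_\lambda$ with (i) if $T_{i,j}\le\mu_j$ then $T_{i,j}=i$; (ii) if $T_{i_1,j}\ne i_1$ and $i_2>i_1$ then $T_{i_1,j}>T_{i_2,j}$; (iii) if $T_{i,j}=i$ and $T_{i',j}=\bar i$ then $i'<i$; (iv) for every $j>1$ and every $i$ there is $i'\ge i$ with $T_{i',j-1}\ge T_{i,j}$. *)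

(* Defs.v *)
From HB Require Import structures.
From mathcomp Require Import all_boot all_order all_algebra complex Rstruct.
Set Implicit Arguments. Unset Strict Implicit. Unset Printing Implicit Defensive.
Import Order.TTheory GRing.Theory Num.Theory.
Local Open Scope ring_scope.

Definition C : fieldType := (Rdefinitions.R)[i].

(* Conventions: W = C^{2n} is 'cV[C]_(2*n); the basis vector w_t (1-based t in
   {1..2n}, i.e. N = {1<..<n<nbar<..<1bar} with ibar = 2n+1-i) is stored at
   0-based row index t-1. *)

Definition bar (n i : nat) : nat := ((2 * n).+1 - i)%N.

(* symplectic form: <w_i, w_ibar> = 1 = - <w_ibar, w_i> for 1 <= i <= n
   (0-based: index t < n paired with rev_ord t = 2n-1-t) *)
Definition symp (n : nat) (u v : 'cV[C]_(2 * n)) : C :=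
  \sum_(t < 2 * n | (t < n)%N) (u t 0 * v (rev_ord t) 0 - u (rev_ord t) 0 * v t 0).

Definition pr13 (n k : nat) (u : 'cV[C]_(2 * n)) : 'cV[C]_(2 * n) :=
  \col_(t < 2 * n) (if (t < k)%N || (2 * n - k <= t)%N then u t 0 else 0).

Definition prk (n k : nat) (u : 'cV[C]_(2 * n)) : 'cV[C]_(2 * n) :=
  \col_(t < 2 * n) (if t.+1 == k then 0 else u t 0).

(* A point of the multi-cone over Sp F^a_{2n}: for every k in 1..n a 2n x k
   matrix A k whose columns form a basis of U_k (so the Pluecker vector of U_k
   is the wedge of the columns, a nonzero representative of the point of
   P(wedge^k C^{2n})). *)
Definition in_variety (n : nat) (A : forall k : nat, 'M[C]_(2 * n, k)) : Prop :=
  [/\ (forall k, (1 <= k <= n)%N -> \rank (A k) = k),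
      (forall k, (1 <= k <= n)%N -> forall x y : 'cV[C]_k,
          symp (pr13 k (A k *m x)) (pr13 k (A k *m y)) = 0)
    & (forall k, (1 <= k < n)%N -> forall x : 'cV[C]_k,
          exists y : 'cV[C]_k.+1, prk k.+1 (A k *m x) = A k.+1 *m y)].

(* entry of a matrix at 1-based row index t (0 if out of range) *)
Definition ent (m k : nat) (A : 'M[C]_(m, k)) (t : nat) (c : 'I_k) : C :=
  if @insub _ (fun s => (s < m)%N) 'I_m t.-1 is Some r then A r c else 0.

(* Pluecker coordinate X_{idx 1, ..., idx k} evaluated at the point
   u_1 /\ ... /\ u_k, u_c = columns of A: (w_{j1}/\../\w_{jk})^*(u_1/\../\u_k)
   = det [ (u_c)_{j_r} ]_{r,c}. *)
Definition plucker (m k : nat) (A : 'M[C]_(m, k)) (idx : nat -> nat) : C :=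
  \det (\matrix_(r < k, c < k) ent A (idx r.+1) c).

(* lambda as the partition (lambda_1 >= ... >= lambda_n), lam = [:: l_1; ...; l_n] *)
Definition lam1 (lam : seq nat) : nat := head 0%N lam.
(* mu_j = length of column j (1-based) *)
Definition mu (lam : seq nat) (j : nat) : nat := count (fun x => (j <= x)%N) lam.

(* Fillings of Y_lambda with entries in N = {1..2n}: cell (i,j) (1-based) is
   stored at (i-1, j-1); an entry e : 'I_(2n) stands for the element e+1 of N. *)
Definition tab (n : nat) (lam : seq nat) : finType :=
  {ffun 'I_n * 'I_(lam1 lam) -> 'I_(2 * n)}.

(* T_{i,j} with 1-based i, j (0 outside the n x lambda_1 rectangle) *)
Definition tabE (n : nat) (lam : seq nat) (F : tab n lam) (i j : nat) : nat :=
  match @insub _ (fun s => (s < n)%N) 'I_n i.-1,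
        @insub _ (fun s => (s < lam1 lam)%N) 'I_(lam1 lam) j.-1 with
  | Some r, Some c => (val (F (r, c))).+1
  | _, _ => 0%N
  end.

Definition XT (n : nat) (lam : seq nat) (F : tab n lam)
    (A : forall k : nat, 'M[C]_(2 * n, k)) : C :=
  \prod_(1 <= j < (lam1 lam).+1) plucker (A (mu lam j)) (fun i => tabE F i j).

(* Symplectic PBW-semistandard tableaux (conditions (i)-(iv)); cells outside
   Y_lambda are required to carry the dummy value 0 so that each tableau has a
   unique representative. *)
Definition SyST (n : nat) (lam : seq nat) (T : tab n lam) : bool :=
  let cols := iota 1 (lam1 lam) in
  let col j := iota 1 (mu lam j) in
  [&& [forall rc : 'I_n * 'I_(lam1 lam),
          (rc.1 < mu lam rc.2.+1)%N || (val (T rc) == 0%N)],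
      all (fun j => all (fun i =>
          (tabE T i j <= mu lam j)%N ==> (tabE T i j == i)) (col j)) cols,
      all (fun j => all (fun i1 => all (fun i2 =>
          ((tabE T i1 j != i1) && (i1 < i2)%N) ==> (tabE T i2 j < tabE T i1 j)%N)
          (col j)) (col j)) cols,
      all (fun j => all (fun i => all (fun i' =>
          ((tabE T i j == i) && (tabE T i' j == bar n i)) ==> (i' < i)%N)
          (col j)) (col j)) cols
    &
      all (fun j => (1 < j)%N ==> all (fun i =>
          has (fun i' => (i <= i')%N && (tabE T i j <= tabE T i' j.-1)%N)
              (iota 1 (mu lam j.-1))) (col j)) cols].

(* Main.v *)
Require Import Defs.
From mathcomp Require Import all_boot all_order all_algebra all_fingroup complex Rstruct.
From mathcomp Require Import zify ring.
Set Implicit Arguments. Unset Strict Implicit. Unset Printing Implicit Defensive.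
Import Order.TTheory GRing.Theory Num.Theory.
Local Open Scope ring_scope.

(** Spanning uses only the incidence and isotropy relations. The Garnir relation
    attached to a violation of (iv) between two neighbouring columns strictly
    decreases the profile [r |-> max_(q >= r) f q] of the right-hand column at the
    violated row without increasing it at any lower row, so that PBW-sorted columns satisfying (iv)
    span. The isotropy of the subspaces lets one rewrite a column that contains
    too many pairs [{a, bar a}] with [a <= i] by columns in which such pairs have
    moved to larger indices; this eliminates the violations of (iii).

    Independence is tested on the curve [z |-> A_k(z)] in the big cell, where
    [A_k(z)] has entries [z^(e c t)] below an identity block. For a strictly
    supermodular exponent [e] the coordinate of a PBW-sorted column has degree
    [sum e r (f r)] over its cells with [f r <> r], and [e] can be chosen
    symmetric (so that the curve is isotropic) and such that these degrees
    separate standard tableaux. Since leading terms of distinct degrees do not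
    cancel, every tableau occurring in an expansion has degree at most that of the
    expanded monomial, which is what makes the alternation of the two
    straightening procedures terminate.

    Indices are 0-based: a column is a function [f : nat -> nat] read on
    [0 .. k-1], and [bar t] is [N.-1 - t] with [N = 2 * n]. *)

(** * Spans with controlled support, and leading terms along a curve *)

Section Span.
Variables (K : fieldType) (Pt : Type) (I : finType).
Implicit Types (V : Pt -> Prop) (X : I -> Pt -> K) (Q : I -> Prop) (p : Pt -> K).

(** The coefficients do not depend on the point. [Q] limits the generators that occur, which is how
    degree bounds on expansions reach the later inductions. *)
Definition inspan V X Q p := exists2 c : I -> K,
  (forall i, c i != 0 -> Q i) & (forall P, V P -> p P = \sum_i c i * X i P).

Lemma inspan_ext V X Q p p' :
  (forall P, V P -> p P = p' P) -> inspan V X Q p' -> inspan V X Q p.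
Proof. by move=> e [c cQ cE]; exists c => // P VP; rewrite e // cE. Qed.

Lemma inspan0 V X Q p : (forall P, V P -> p P = 0) -> inspan V X Q p.
Proof.
move=> p0; exists (fun=> 0) => [i|P VP]; first by rewrite eqxx.
by rewrite p0 // big1 // => i _; rewrite mul0r.
Qed.

Lemma inspan_gen V X (Q : I -> Prop) i : Q i -> inspan V X Q (X i).
Proof.
move=> Qi; exists (fun j => (j == i)%:R) => [j|P VP].
  by case: (j =P i) => [->//|_]; rewrite eqxx.
by rewrite (bigD1 i) //= eqxx mul1r big1 ?addr0 // => j /negPf e; rewrite e mul0r.
Qed.

Lemma inspanD V X Q p p' : inspan V X Q p -> inspan V X Q p' ->
  inspan V X Q (fun P => p P + p' P).
Proof.
move=> [c cQ cE] [c' c'Q c'E]; exists (fun i => c i + c' i) => [i|P VP].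
  have [c0|/cQ//] := eqVneq (c i) 0; rewrite c0 add0r; exact: c'Q.
by rewrite cE // c'E // -big_split; apply: eq_bigr => i _; rewrite mulrDl.
Qed.

Lemma inspanZ V X Q a p : inspan V X Q p -> inspan V X Q (fun P => a * p P).
Proof.
move=> [c cQ cE]; exists (fun i => a * c i) => [i|P VP].
  by rewrite mulf_eq0 => /norP[_ /cQ].
by rewrite cE // mulr_sumr; apply: eq_bigr => i _; rewrite mulrA.
Qed.

Lemma inspan_sum V X Q (J : Type) (r : seq J) (D : pred J) (p : J -> Pt -> K) :
  (forall j, D j -> inspan V X Q (p j)) ->
  inspan V X Q (fun P => \sum_(j <- r | D j) p j P).
Proof.
move=> H; elim: r => [|j r IH]; first by apply: inspan0 => P _; rewrite big_nil.
case: (boolP (D j)) => Dj.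
  apply: inspan_ext (inspanD (H j Dj) IH) => P _; by rewrite big_cons Dj.
by apply: inspan_ext IH => P _; rewrite big_cons (negPf Dj).
Qed.

(* If the generators restrict along a curve to polynomials of pairwise distinct
   degrees, leading terms cannot cancel. *)
Lemma size_sum_distinct (p : I -> {poly K}) (c : I -> K) :
    (forall i, c i != 0 -> p i != 0) ->
    (forall i j, c i != 0 -> c j != 0 -> size (p i) = size (p j) -> i = j) ->
  forall i, c i != 0 -> (size (p i) <= size (\sum_j c j *: p j)%R)%N.
Proof.
move=> p0 inj i ci.
have [m cm maxm] := @arg_maxnP _ i (fun j => c j != 0) (fun j => size (p j)) ci.
apply: leq_trans (maxm i ci) _; rewrite leqNgt; apply/negP => lt.
have pm0 := p0 m cm.
have sm : (0 < size (p m))%N by rewrite size_poly_gt0.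
have : (\sum_j c j *: p j)`_(size (p m)).-1 = 0.
  by apply: nth_default; rewrite -ltnS prednK.
rewrite coef_sum (bigD1 m) //= big1 ?addr0.
  move/eqP; rewrite coefZ mulf_eq0 (negPf cm) /= -/(lead_coef _).
  by rewrite lead_coef_eq0 (negPf pm0).
move=> j jm; rewrite coefZ.
have [->|cj] := eqVneq (c j) 0; first by rewrite mul0r.
rewrite nth_default ?mulr0 //.
have := maxm j cj; rewrite /= leq_eqVlt => /orP[/eqP e|]; last by lia.
by move/eqP: jm; case; apply: inj.
Qed.

End Span.

(** In characteristic zero the natural numbers give infinitely many roots of [p - q]. *)
Lemma poly_eval_inj (K : fieldType) (K0 : forall m, m.+1%:R != 0 :> K) (p q : {poly K}) :
  (forall z, p.[z] = q.[z]) -> p = q.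
Proof.
move=> e; apply/eqP; rewrite -subr_eq0; apply/eqP.
set d := p - q.
have K0' : injective (fun m : nat => m%:R : K).
  have H a b : (a <= b)%N -> a%:R = b%:R :> K -> a = b.
    move=> ab /eqP; rewrite eq_sym -subr_eq0 -natrB //.
    case E : (b - a)%N => [|m]; first by lia.
    by rewrite (negPf (K0 m)).
  by move=> a b E; case/orP: (leq_total a b) => ab; [|symmetry]; apply: H.
apply: (@roots_geq_poly_eq0 _ _ [seq m%:R | m <- iota 0 (size d)]).
- by apply/allP => z _; rewrite rootE /d !hornerE e subrr.
- by rewrite map_inj_uniq ?iota_uniq.
- by rewrite size_map size_iota.
Qed.

Section Restrict.
Variables (K : fieldType) (K0 : forall m, m.+1%:R != 0 :> K).
Variables (Pt : Type) (I : finType).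

(** Along the curve the expansion becomes an identity of polynomials. As the degrees are distinct,
    no generator of degree above that of [p] can have a nonzero coefficient; the coefficients
    themselves are kept. *)
Lemma inspan_restrict (V : Pt -> Prop) (X : I -> Pt -> K) (Q : I -> Prop)
    (p : Pt -> K) (gam : K -> Pt) (pX : I -> {poly K}) (pp : {poly K}) :
    (forall z, V (gam z)) ->
    (forall i z, Q i -> X i (gam z) = (pX i).[z]) ->
    (forall z, p (gam z) = pp.[z]) ->
    (forall i, Q i -> pX i != 0) ->
    (forall i j, Q i -> Q j -> size (pX i) = size (pX j) -> i = j) ->
  inspan V X Q p ->
  inspan V X (fun i => Q i /\ (size (pX i) <= size pp)%N) p.
Proof.
move=> Vg eX ep nz inj [c cQ cE]; exists c => // i ci; split; first exact: cQ.
have -> : pp = \sum_j c j *: pX j.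
  apply: poly_eval_inj => // z; rewrite -ep cE // horner_sum.
  apply: eq_bigr => j _; rewrite hornerZ.
  by have [->|/cQ cj] := eqVneq (c j) 0; rewrite ?mul0r // eX.
apply: size_sum_distinct => // [j /cQ|j j' /cQ Qj /cQ]; [exact: nz | exact: inj].
Qed.

End Restrict.

(** * Minors and PBW sorting *)

Section Minor.
Variable K : fieldType.
Implicit Types (f g : nat -> nat) (M : nat -> nat -> K).

Definition minor k M f : K := \det (\matrix_(r < k, c < k) M (f r) c).

Lemma eq_minor k M f g : (forall r, (r < k)%N -> f r = g r) -> minor k M f = minor k M g.
Proof. by move=> e; congr (\det _); apply/matrixP => r c; rewrite !mxE e. Qed.

Lemma minor_dup k M f (i j : 'I_k) : i != j -> f i = f j -> minor k M f = 0.
Proof.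
by move=> ij e; apply: (determinant_alternate ij) => c; rewrite !mxE e.
Qed.

Lemma minor_injP k f : (forall M, minor k M f = 0) \/ injective (fun r : 'I_k => f r).
Proof.
case: (boolP (injectiveb (fun r : 'I_k => f r))) => [/injectiveP|]; first by right.
move=> /injectivePn[i [j ij e]]; left => M; exact: minor_dup ij e.
Qed.

Definition permf k (s : 'S_k) f r : nat :=
  if insub r is Some i then f (s i) else f r.

Lemma permfE k (s : 'S_k) f (i : 'I_k) : permf s f i = f (s i).
Proof. by rewrite /permf valK. Qed.

Lemma minor_permf k M f (s : 'S_k) : minor k M (permf s f) = (-1) ^+ s * minor k M f.
Proof.
have -> : minor k M (permf s f) = \det (row_perm s (\matrix_(r < k, c < k) M (f r) c)).
  by congr (\det _); apply/matrixP => r c; rewrite !mxE permfE.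
by rewrite row_permE det_mulmx det_perm.
Qed.

End Minor.

(** Conditions (i) and (ii) for a column of length [k], rows and entries being counted from 0. *)
Definition pbw k (f : nat -> nat) :=
  (forall r, (r < k)%N -> (f r < k)%N -> f r = r) /\
  (forall r1 r2, (r1 < r2 < k)%N -> f r1 <> r1 -> (f r2 < f r1)%N).

Lemma eq_pbw k (f g : nat -> nat) : (forall r, (r < k)%N -> f r = g r) -> pbw k f -> pbw k g.
Proof.
move=> e [H1 H2]; split=> [r rk|r1 r2 /andP[r12 r2k]]; first by rewrite -e //; apply: H1.
have r1k := ltn_trans r12 r2k.
by rewrite -!e //; apply: H2; rewrite r12.
Qed.

Lemma sum_tperm k (phi : 'I_k -> 'I_k -> nat) (s : 'S_k) (i j : 'I_k) : i != j ->
  (\sum_r phi r ((tperm i j * s)%g r) + (phi i (s i) + phi j (s j)) =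
   \sum_r phi r (s r) + (phi i (s j) + phi j (s i)))%N.
Proof.
move=> ij; rewrite (bigD1 i) //= (bigD1 j) 1?eq_sym //= [in RHS](bigD1 i) //=.
rewrite [in RHS](bigD1 j) 1?eq_sym //= !permM tpermL tpermR.
rewrite (eq_bigr (fun r => phi r (s r))); last first.
  by move=> r /andP[ri rj]; rewrite permM tpermD // eq_sym.
by ring.
Qed.

(* A maximizer over 'S_k of a suitable weight is PBW-sorted, since each failure
   of the PBW conditions gives a transposition increasing the weight. *)
Lemma pbw_sort k (f : nat -> nat) : injective (fun r : 'I_k => f r) ->
  exists s : 'S_k, pbw k (permf s f).
Proof.
move=> injf.
pose m := (\sum_(r < k) f r)%N.
have fm (r : 'I_k) : (f r <= m)%N by rewrite /m (bigD1 r) //= leq_addr.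
(* [m] bounds all entries, so [k * m - r * x] is not truncated. An entry below [k] earns more than
   any such value exactly in its own row; the term [- r * x] favours large entries in small rows. *)
pose psi (r x : nat) := (if x < k then (x == r) * (k * m).+1 else k * m - r * x)%N.
pose phi (r q : 'I_k) := psi r (f q).
have [s _ smax] := @arg_maxnP _ (1%g : 'S_k) predT
   (fun s => \sum_r phi r (s r))%N isT.
exists s.
have H1 (r : 'I_k) : (f (s r) < k)%N -> f (s r) = r.
  move=> lt; apply/eqP/negPn/negP => ne.
  pose j := Ordinal lt; have rj : r != j by rewrite -val_eqE /= eq_sym.
  have := smax (tperm r j * s)%g isT; have := sum_tperm phi s rj.
  rewrite /phi /psi /= lt eqxx (negPf ne) mul0n.
  have ij : f (s j) <> f (s r).
    by move/injf/perm_inj => e; rewrite e eqxx in rj.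
  have ub : ((if f (s j) < k then (f (s j) == f (s r)) * (k * m).+1 else k * m - f (s r) * f (s j)) <= k * m)%N.
    by case: ifP => _; [move/eqP/negPf: ij => -> | apply: leq_subr].
  have key (S S' a b c : nat) : (S' + (0 + a) = S + (b + true * c.+1) -> S' <= S -> a <= c -> False)%N by lia.
  by move=> e1 e2; apply: key e1 e2 ub.
split=> [r rk|r1 r2 /andP[r12 r2k]].
  by rewrite -[r]/(val (Ordinal rk)) permfE; apply: H1.
have r1k := ltn_trans r12 r2k.
rewrite -[r1]/(val (Ordinal r1k)) -[r2]/(val (Ordinal r2k)) !permfE.
set i := Ordinal r1k; set j := Ordinal r2k => ne.
have ik : (k <= f (s i))%N by rewrite leqNgt; apply/negP => /H1.
have ij : i != j by apply/eqP => -[]; move: r12; lia.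
rewrite ltnNge leq_eqVlt; apply/negP => /orP[/eqP/injf/perm_inj e|lt].
  by rewrite e eqxx in ij.
have := smax (tperm i j * s)%g isT; have := sum_tperm phi s ij.
rewrite /phi /psi /= !ltnNge ik (ltnW (leq_ltn_trans ik lt)) /=.
have := fm (s i); have := fm (s j).
have B (r : nat) x : (r < k -> x <= m -> r * x <= k * m)%N by move=> *; apply: leq_mul; rewrite // ltnW.
move=> fj fi; have := B _ _ r1k fi; have := B _ _ r1k fj; have := B _ _ r2k fi; have := B _ _ r2k fj.
move: (f (s i)) (f (s j)) lt => x y lt b1 b2 b3 b4.
have : (r1 * y + r2 * x < r1 * x + r2 * y)%N by move: r12 lt; clear; nia.
have key (S S' c p q u v : nat) : (p <= c -> q <= c -> u <= c -> v <= c -> p + v < q + u ->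
  S' + (c - q + (c - u)) = S + (c - p + (c - v)) -> S' <= S -> False)%N by clear; lia.
by move=> lt2 e1 e2; apply: key lt2 e1 e2.
Qed.

Lemma pbw_inj k (f : nat -> nat) : pbw k f -> injective (fun r : 'I_k => f r).
Proof.
move=> [H1 H2] r q e; apply: val_inj => /=.
wlog lt : r q e / (r < q)%N.
  move=> W; case: (ltngtP r q) => // [/(W _ _ e)//|/(W _ _ (esym e))//].
have lqk : (r < q < k)%N by rewrite lt ltn_ord.
have [er|/eqP ne] := eqVneq (f r) r.
  by rewrite -(H1 q (ltn_ord q)) -?e er // ltn_ord.
by have := H2 _ _ lqk ne; rewrite /= e ltnn.
Qed.

(** * The Garnir relation *)

Lemma card_ord_interval N p q : (q <= N)%N -> #|[set x : 'I_N | (p <= x < q)%N]| = (q - p)%N.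
Proof.
move=> qN; rewrite cardsE -sum1_card big_mkcond /=.
have -> : (\sum_(i < N) (if (i : 'I_N) \in [pred x : 'I_N | (p <= x < q)%N] then 1 else 0) =
  minn N q - p)%N; last by rewrite (minn_idPr qN).
elim: N {qN} => [|N IH]; first by rewrite big_ord0 min0n.
rewrite big_ord_recr /= {}IH inE /=; case: ifP; lia.
Qed.

Definition cnt k (D : pred nat) (g : nat -> nat) := #|[set r : 'I_k | D (g r)]|.

Lemma cnt_permf k D (s : 'S_k) g : cnt k D (permf s g) = cnt k D g.
Proof.
rewrite /cnt -[RHS](card_preimset _ (@perm_inj _ s)); apply: eq_card => r.
by rewrite !inE permfE.
Qed.

Lemma perm_stable k l (s : 'S_(k + l)) :
  (forall x : 'I_(k + l), (x < k)%N -> (s x < k)%N) ->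
  forall x : 'I_(k + l), (s x < k)%N = (x < k)%N.
Proof.
move=> H; pose L := [set x : 'I_(k + l) | (x < k)%N].
have sub : [set s x | x in L] \subset L.
  by apply/subsetP => y /imsetP[x]; rewrite !inE => xk ->; apply: H.
have /eqP e : [set s x | x in L] == L.
  by rewrite eqEcard sub (card_imset _ (@perm_inj _ s)) leqnn.
move=> x; apply/idP/idP; last exact: H.
move=> sx; have : s x \in L by rewrite inE.
by rewrite -e => /imsetP[y]; rewrite inE => yk /perm_inj ->.
Qed.

(* The first [k] columns are supported on fewer than [k] rows. *)
Lemma det_zero_block (K : fieldType) k l (M : 'M[K]_(k + l)) (Z : {set 'I_(k + l)}) :
    (#|Z| < k)%N ->
    (forall x (c : 'I_k), x \notin Z -> M x (lshift l c) = 0) ->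
  \det M = 0.
Proof.
move=> cZ MZ; rewrite /determinant big1 // => s _.
have [x /andP[xZ xk]] : exists x : 'I_(k + l), (x \notin Z) && (s x < k)%N.
  apply/existsP; apply: contraT => /existsPn H.
  have : #|[set x | (s x < k)%N]| = k.
    have -> : [set x | (s x < k)%N] = s @^-1: [set x : 'I_(k + l) | (0 <= x < k)%N].
      by apply/setP => x; rewrite !inE.
    by rewrite (card_preimset _ (@perm_inj _ s)) card_ord_interval ?subn0 ?leq_addr.
  have /subset_leq_card : [set x | (s x < k)%N] \subset Z.
    apply/subsetP => x; rewrite inE => sx; have := H x.
    by rewrite sx andbT negbK.
  by move=> le e; rewrite e leqNgt cZ in le.
have e : s x = lshift l (Ordinal xk) by apply: val_inj.
by rewrite (bigD1 x) //= e MZ // mul0r mulr0.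
Qed.

(* Rows [x < k] are those of the right column [g], rows [x >= k] those of the left
   column [f]. Rows [x <= a] of [g] and [x >= k + a] of [f] are alternated; the other
   rows of [g] (resp. [f]) are kept in the first (resp. second) determinant by giving
   them weight zero in the other one. Since the first [k] columns of the
   resulting square matrix are, modulo the last [l], supported on [k - 1] rows,
   its determinant vanishes, and so does its Laplace expansion. *)
Section Garnir.
Variables (K : fieldType) (k l a : nat) (ak : (a < k)%N) (kl : (k <= l)%N).
Variables (g f : nat -> nat).
Implicit Types (x y : 'I_(k + l)) (s : 'S_(k + l)).

Definition gar_h x : nat := if (x < k)%N then g x else f (x - k).
(** Besides the rows of [g], the first minor may take rows of [f] from [a] on, except those with
    value in [[k, l)]: there the incidence relation has 0 in place of [A]. *)
Definition gar_w x : bool :=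
  (x < k)%N || ((k + a <= x)%N && ~~ (k <= f (x - k) < l)%N).
Definition gar_v x : bool := ~~ (a < x < k)%N.
Definition gar_ok s : bool :=
  [forall x : 'I_(k + l), if (x < k)%N then gar_w (s x) else gar_v (s x)].
Definition gar_pres s : bool := [forall x : 'I_(k + l), (s x < k)%N == (x < k)%N].
Definition gar_g s r : nat := if insub r is Some r' then gar_h (s (lshift l r')) else 0%N.
Definition gar_f s r : nat := if insub r is Some r' then gar_h (s (rshift k r')) else 0%N.

Lemma gar_gE s (r : 'I_k) : gar_g s r = gar_h (s (lshift l r)).
Proof. by rewrite /gar_g valK. Qed.

Lemma gar_fE s (r : 'I_l) : gar_f s r = gar_h (s (rshift k r)).
Proof. by rewrite /gar_f valK. Qed.

Variables A B Y : nat -> nat -> K.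
Hypothesis AB : forall t c, (c < k)%N ->
  (if (k <= t < l)%N then 0 else A t c) = \sum_(d < l) B t d * Y d c.
Hypothesis ga : forall r, (r <= a)%N -> ~~ (k <= g r < l)%N.

Let NA : 'M[K]_(k + l, k) := \matrix_(x, c) ((gar_w x)%:R * A (gar_h x) c).
Let NB : 'M[K]_(k + l, l) := \matrix_(x, c) ((gar_v x)%:R * B (gar_h x) c).

Lemma gar_det0 (s : 'S_k) (t : 'S_l) : \det (row_mx (col_perm s NA) (col_perm t NB)) = 0.
Proof.
rewrite !col_permE.
have -> : row_mx (NA *m perm_mx s^-1) (NB *m perm_mx t^-1) =
          row_mx NA NB *m block_mx (perm_mx s^-1) 0 0 (perm_mx t^-1).
  by rewrite mul_row_block !mulmx0 addr0 add0r.
rewrite det_mulmx.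
suff -> : \det (row_mx NA NB) = 0 by rewrite mul0r.
pose y : 'M[K]_(l, k) := \matrix_(d, c) Y d c.
(* Column operations turn [NA] into [NA - NB *m y]. By [AB] and [ga] its rows vanish outside
   [a < x < k + a], which leaves [k - 1] rows for [k] columns. *)
have -> : \det (row_mx NA NB) = \det (row_mx NA NB *m block_mx 1%:M 0 (- y) 1%:M).
  by rewrite det_mulmx det_lblock !det1 !mulr1.
rewrite mul_row_block !mulmx0 !mulmx1 add0r mulmxN.
apply: (@det_zero_block _ _ _ _ [set x : 'I_(k + l) | (a.+1 <= x < k + a)%N]).
  by rewrite card_ord_interval; lia.
move=> x c; rewrite inE row_mxEl => nZ; rewrite !mxE.
rewrite (eq_bigr (fun d : 'I_l => (gar_v x)%:R * (B (gar_h x) d * Y d c))); last first.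
  by move=> d _; rewrite !mxE mulrA.
have -> : gar_v x by rewrite /gar_v; lia.
rewrite -mulr_sumr mul1r -AB // /gar_h /gar_w.
case: ifP => xk /=; last first.
  have -> : (k + a <= x)%N by lia.
  by case: ifP; rewrite ?mul0r ?mul1r subrr.
by rewrite (negPf (ga _)) ?mul1r ?subrr //; lia.
Qed.

(** Expanding both minors over permutations [u], [t] of their columns and exchanging the sums turns
    each inner sum over [s] into a determinant of [gar_det0]. Summing over the whole symmetric group
    avoids choosing shuffles. *)
Lemma gar_laplace : \sum_(s : 'S_(k + l)) (-1) ^+ s *
  (\det (\matrix_(r < k, c < k) NA (s (lshift l r)) c) *
   \det (\matrix_(r < l, c < l) NB (s (rshift k r)) c)) = 0.
Proof.
transitivity (\sum_(u : 'S_k) \sum_(t : 'S_l) (-1) ^+ u * (-1) ^+ t *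
   \det (row_mx (col_perm u NA) (col_perm t NB))); last first.
  by rewrite big1 // => u _; rewrite big1 // => t _; rewrite gar_det0 mulr0.
rewrite (eq_bigr (fun s : 'S_(k + l) => \sum_(u : 'S_k) \sum_(t : 'S_l) (-1) ^+ s *
   ((-1) ^+ u * (\prod_i NA (s (lshift l i)) (u i)) *
    ((-1) ^+ t * (\prod_i NB (s (rshift k i)) (t i)))))); last first.
  move=> s _; rewrite /determinant mulr_suml mulr_sumr; apply: eq_bigr => u _.
  rewrite !mulr_sumr; apply: eq_bigr => t _; congr (_ * (_ * _ * (_ * _))).
    by apply: eq_bigr => i _; rewrite mxE.
  by apply: eq_bigr => i _; rewrite mxE.
rewrite exchange_big; apply: eq_bigr => u _ /=.
rewrite exchange_big; apply: eq_bigr => t _ /=.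
rewrite -det_tr /determinant mulr_sumr; apply: eq_bigr => s _.
rewrite big_split_ord /=.
rewrite [X in _ = _ * (_ * (X * _))](eq_bigr (fun i => NA (s (lshift l i)) (u i))); last first.
  by move=> i _; rewrite mxE row_mxEl mxE.
rewrite [X in _ = _ * (_ * (_ * X))](eq_bigr (fun i => NB (s (rshift k i)) (t i))); last first.
  by move=> i _; rewrite mxE row_mxEr mxE.
move: ((-1) ^+ s) ((-1) ^+ u) ((-1) ^+ t) (\prod_i NA _ _) (\prod_i NB _ _) => b c d x y.
ring.
Qed.

Lemma det_row_scale m (w : 'I_m -> bool) (N : 'I_m -> 'I_m -> K) :
  \det (\matrix_(r, c) ((w r)%:R * N r c)) = ([forall r, w r])%:R * \det (\matrix_(r, c) N r c).
Proof.
have -> : \matrix_(r, c) ((w r)%:R * N r c) =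
   diag_mx (\row_r (w r)%:R) *m \matrix_(r, c) N r c.
  by apply/matrixP => r c; rewrite mul_diag_mx !mxE.
rewrite det_mulmx det_diag; congr (_ * _).
case: forallP => [H|/forallP/forallPn[r /negPf H]].
  by rewrite big1 // => r _; rewrite mxE H.
by rewrite (bigD1 r) //= mxE H mul0r.
Qed.

Lemma gar_sum : \sum_(s : 'S_(k + l) | gar_ok s) (-1) ^+ s *
  (minor k A (gar_g s) * minor l B (gar_f s)) = 0.
Proof.
rewrite big_mkcond -[RHS]gar_laplace; apply: eq_bigr => s _.
have -> : \matrix_(r < k, c < k) NA (s (lshift l r)) c =
  \matrix_(r < k, c < k) ((gar_w (s (lshift l r)))%:R * A (gar_g s r) c).
  by apply/matrixP => r c; rewrite !mxE gar_gE.
have -> : \matrix_(r < l, c < l) NB (s (rshift k r)) c =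
  \matrix_(r < l, c < l) ((gar_v (s (rshift k r)))%:R * B (gar_f s r) c).
  by apply/matrixP => r c; rewrite !mxE gar_fE.
rewrite !det_row_scale.
have -> : gar_ok s = [forall r, gar_w (s (lshift l r))] && [forall r, gar_v (s (rshift k r))].
  apply/forallP/andP => [H|[/forallP H1 /forallP H2] x].
    split; apply/forallP => r; first by have := H (lshift l r); rewrite /= ltn_ord.
    by have := H (rshift k r); rewrite /= ltnNge leq_addr.
  by case: (split_ordP x) => j ->; rewrite /= ?ltn_ord ?(ltnNge (k + _)) ?leq_addr.
by case: forallP; case: forallP; rewrite ?mul0r ?mulr0 ?mul1r.
Qed.

(** [s] permutes the rows of a block diagonal matrix, and the sign this produces cancels the sign of
    the term. *)
Lemma gar_presE s : gar_pres s -> (-1) ^+ s *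
  (minor k A (gar_g s) * minor l B (gar_f s)) = minor k A g * minor l B f.
Proof.
move=> /forallP ps.
pose Z : 'M[K]_(k + l) := block_mx (\matrix_(r < k, c < k) A (g r) c) 0 0
                                   (\matrix_(r < l, c < l) B (f r) c).
have -> : minor k A g * minor l B f = \det Z by rewrite /Z det_ublock.
have -> : minor k A (gar_g s) * minor l B (gar_f s) = \det (row_perm s Z).
  rewrite -[LHS](@det_ublock _ _ _ _ 0); congr (\det _).
  apply/matrixP => x y; rewrite [RHS]mxE.
  have ls (r : 'I_k) : (s (lshift l r) < k)%N by rewrite (eqP (ps _)) /= ltn_ord.
  have rs (r : 'I_l) : (k <= s (rshift k r))%N.
    by rewrite leqNgt (eqP (ps _)) /= -leqNgt leq_addr.
  case: (split_ordP x) => r ->.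
    have [r' er] : exists r', s (lshift l r) = lshift l r'.
      by exists (Ordinal (ls r)); apply: val_inj.
    rewrite er /Z; case: (split_ordP y) => c ->; rewrite ?block_mxEul ?block_mxEur ?mxE //.
    by rewrite gar_gE /gar_h er /= ltn_ord.
  have er : exists r', s (rshift k r) = rshift k r'.
    case: (split_ordP (s (rshift k r))) => r' e; last by exists r'.
    by have := rs r; rewrite e /= leqNgt ltn_ord.
  case: er => r' er.
  rewrite er /Z; case: (split_ordP y) => c ->; rewrite ?block_mxEdl ?block_mxEdr ?mxE //.
  by rewrite gar_fE /gar_h er /= ltnNge leq_addr /= addKn.
by rewrite row_permE det_mulmx det_perm mulrA -expr2 sqrr_sign mul1r.
Qed.

Lemma gar_pres_ok s : gar_pres s -> gar_ok s.
Proof.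
move=> /forallP ps; apply/forallP => x; have /eqP e := ps x.
by case: ifP => xk; rewrite /gar_w /gar_v e xk // andbF.
Qed.

(** The relation solved for the original product. Its coefficient, the number of block-preserving
    permutations, is invertible in characteristic zero. *)
Lemma garnir : (#|[pred s : 'S_(k + l) | gar_pres s]|)%:R * (minor k A g * minor l B f) =
  - \sum_(s : 'S_(k + l) | gar_ok s && ~~ gar_pres s) (-1) ^+ s *
  (minor k A (gar_g s) * minor l B (gar_f s)).
Proof.
apply/eqP; rewrite -addr_eq0 -[X in _ == X]gar_sum [X in _ == X](bigID gar_pres) /=; apply/eqP.
congr (_ + _); rewrite (eq_bigl gar_pres); last first.
  by move=> s /=; case: (boolP (gar_pres s)) => [/gar_pres_ok ->|]; rewrite ?andbF.
rewrite (eq_bigr (fun=> minor k A g * minor l B f)); last exact: gar_presE.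
by rewrite sumr_const mulr_natl.
Qed.

End Garnir.

Lemma gar_pres_gt0 k l : (0 < #|[pred s : 'S_(k + l) | gar_pres s]|)%N.
Proof.
apply/card_gt0P; exists 1%g; rewrite inE; apply/forallP => x; by rewrite perm1.
Qed.

Section GarnirCount.
Variables (k l a : nat) (ak : (a < k)%N) (kl : (k <= l)%N).
Variables (g f : nat -> nat) (s : 'S_(k + l)).
Hypothesis s_ok : @gar_ok k l a f s.

Let S (D : pred nat) := [set y : 'I_(k + l) | (s^-1%g y < k)%N && D (gar_h g f y)].

Lemma cnt_gar_g D : cnt k D (gar_g g f s) = #|S D|.
Proof.
have inj : injective (fun r : 'I_k => s (lshift l r)).
  by move=> r r' /perm_inj /lshift_inj.
rewrite /cnt -(card_imset _ inj); apply: eq_card => y.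
apply/imsetP/idP => [[r]|].
  by rewrite !inE gar_gE => Dr ->; rewrite permK Dr /= ltn_ord.
rewrite inE => /andP[yk Dy]; exists (Ordinal yk).
  rewrite inE gar_gE; have -> : lshift l (Ordinal yk) = s^-1%g y by apply: val_inj.
  by rewrite permKV.
by have -> : lshift l (Ordinal yk) = s^-1%g y by [apply: val_inj]; rewrite permKV.
Qed.

Lemma gar_fixed (y : 'I_(k + l)) : (a < y < k)%N -> (s^-1%g y < k)%N.
Proof.
move=> ay; have := forallP s_ok (s^-1%g y); rewrite permKV.
by case: ifP => // _; rewrite /gar_v ay.
Qed.

(** Rows [y] of the stack with [a < y < k] have weight zero in the second minor, so they stay in the
    first. Values found only there are not lost. *)
Lemma cnt_gar_ge (D : pred nat) : (forall r, (r < k)%N -> D (g r) -> (a < r)%N) ->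
  (cnt k D g <= cnt k D (gar_g g f s))%N.
Proof.
move=> Da; rewrite cnt_gar_g /cnt -(card_imset _ (@lshift_inj k l)).
apply: subset_leq_card; apply/subsetP => y /imsetP[r]; rewrite !inE => Dr ->.
by rewrite /gar_h /= ltn_ord Dr andbT gar_fixed // /= ltn_ord Da.
Qed.

(** Besides the [k - a.+1] fixed rows after [a], a permutation that is not block-preserving brings
    some row of [f] of index at least [a] into the first minor. *)
Lemma cnt_gar_gt (D : pred nat) : ~~ gar_pres s ->
  (forall r, (a < r < k)%N -> D (g r)) ->
  (forall i, (a <= i < l)%N -> D (f i)) ->
  (k - a <= cnt k D (gar_g g f s))%N.
Proof.
move=> np Dg Df; rewrite cnt_gar_g.
have [x xk sx] : exists2 x : 'I_(k + l), (x < k)%N & (k <= s x)%N.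
  apply/exists_inP; apply: contraT => /exists_inPn H; case/negP: np.
  apply/forallP => x; rewrite perm_stable // => {}x xk.
  by rewrite ltnNge; apply: H.
have wx := forallP s_ok x; rewrite xk in wx.
pose U := [set y : 'I_(k + l) | (a.+1 <= y < k)%N].
have sxU : s x \notin U by rewrite inE; lia.
have -> : (k - a = #|s x |: U|)%N.
  by rewrite cardsU1 sxU card_ord_interval; lia.
apply: subset_leq_card; apply/subsetP => y; rewrite in_setU1 => /orP[/eqP ->|].
  rewrite inE permK xk /gar_h ltnNge sx /=; apply: Df.
  move: wx; rewrite /gar_w; have := ltn_ord (s x); lia.
rewrite !inE => ay; rewrite gar_fixed //= /gar_h.
by move/andP: (ay) => [_ ->]; apply: Dg.
Qed.

End GarnirCount.

(** * Profiles and their decrease in a Garnir step *)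

Lemma base_lt N k (u : nat -> nat) : (forall p, (p < k)%N -> (u p < N)%N) ->
  (\sum_(p < k) u p * N ^ p < N ^ k)%N.
Proof.
elim: k => [|k IH] uN; first by rewrite big_ord0.
rewrite big_ord_recr /= expnS.
have := IH (fun p pk => uN p (ltnW pk)); have := uN k (ltnSn k).
move: (\sum_(i < k) _)%N (N ^ k)%N => x y h1 h2; nia.
Qed.

Lemma lex_lt N k a (u v : nat -> nat) : (a < k)%N ->
    (forall p, (p < k)%N -> (u p < N)%N) ->
    (forall p, (a < p < k)%N -> (u p <= v p)%N) -> (u a < v a)%N ->
  (\sum_(p < k) u p * N ^ p < \sum_(p < k) v p * N ^ p)%N.
Proof.
elim: k => [//|k IH] ak uN uv lt; rewrite !big_ord_recr /=.
have [e|ne] := eqVneq a k.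
  have := @base_lt N k u (fun p pk => uN p (ltnW pk)); rewrite e in lt.
  have key (x y z b c : nat) : (b < c -> x < z -> x + b * z < y + c * z)%N by nia.
  exact: key.
have ak' : (a < k)%N by lia.
have h : (u k <= v k)%N by apply: uv; rewrite ak' ltnSn.
have := IH ak' (fun p pk => uN p (ltnW pk)) _ lt.
rewrite -addSn => H; apply: leq_add; last by rewrite leq_mul2r h orbT.
by apply: H => p pk; apply: uv; lia.
Qed.

(* Condition (iv) for columns [f], [g] says exactly that the profile of [g] is bounded by that of [f]. *)
Definition prof k (g : nat -> nat) p := (\max_(q < k | p <= q) g q)%N.

Lemma leq_prof k g p q : (p <= q < k)%N -> (g q <= prof k g p)%N.
Proof.
move=> /andP[pq qk].
exact: (@leq_bigmax_cond _ (fun q : 'I_k => p <= q)%N (fun q => g q) (Ordinal qk)).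
Qed.

Lemma prof_leP k g p y : reflect (forall q, (p <= q < k)%N -> (g q <= y)%N) (prof k g p <= y)%N.
Proof.
apply: (iffP (bigmax_leqP _ _ _)) => [H q /andP[pq qk]|H q pq].
  exact: (H (Ordinal qk)).
by apply: H; rewrite pq ltn_ord.
Qed.

(** Entries of a sorted column from row [p] on are at least [p]. Together with [prof_of_cnt] this
    describes the profile by counts of values, which sorting does not change. *)
Lemma cnt_prof k g p : pbw k g -> (p < k)%N ->
  (k - p <= cnt k (fun v => p <= v <= prof k g p)%N g)%N.
Proof.
move=> [H1 H2] pk; rewrite -(card_ord_interval p (leqnn k)); apply: subset_leq_card.
apply/subsetP => q; rewrite !inE => /andP[pq qk].
rewrite leq_prof ?pq // andbT.
by case: (ltnP (g q) k) => [/(H1 _ qk) ->//|]; lia.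
Qed.

(** An entry in a row before [p] is either below [p] or, by (ii), larger than every later entry. If
    some later entry exceeded [y], the counted values would therefore lie in fewer than [k - p]
    rows. *)
Lemma prof_of_cnt k g p y : pbw k g -> (p < k <= y.+1)%N ->
  (k - p <= cnt k (fun v => p <= v <= y)%N g)%N -> (prof k g p <= y)%N.
Proof.
move=> [H1 H2] /andP[pk ky] c; apply/prof_leP => q /andP[pq qk].
rewrite leqNgt; apply/negP => yq.
pose Q := Ordinal qk; pose S := [set r : 'I_k | (p <= r < k)%N].
have : (#|Q |: (S :\ Q)| <= k - p)%N.
  by rewrite setD1K ?card_ord_interval // inE /= pq.
rewrite cardsU1 !inE eqxx /= add1n => lt.
have := leq_ltn_trans c _; move/(_ (k - p)%N); rewrite ltnn => /(_ _)/notF; apply.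
apply: leq_trans lt; rewrite ltnS; apply: subset_leq_card.
apply/subsetP => r; rewrite !inE => /andP[pr ry].
have -> /= : r != Q by apply/eqP => e; move: ry; rewrite e /=; lia.
rewrite ltn_ord andbT leqNgt; apply/negP => rp.
have rk := ltn_ord r.
case: (ltnP (g r) k) => [/(H1 _ rk) e|kr]; first by lia.
have : (g q < g r)%N by apply: H2; lia.
by lia.
Qed.

(** Rows of larger index are more significant digits. This fits a Garnir step, which lowers the
    profile at row [a], does not raise it after [a], and is not controlled before [a]. *)
Definition colm N k g := (\sum_(p < k) prof k g p * N ^ p)%N.

Lemma prof_ltN N k g p : (p < k)%N -> (forall r, (r < k)%N -> (g r < N)%N) -> (prof k g p < N)%N.
Proof.
move=> pk gN; have := gN _ pk; case: N gN => // N gN _; rewrite ltnS.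
by apply/prof_leP => q /andP[_ /gN].
Qed.

Section GarnirStep.
Variables (N k l a : nat) (ak : (a < k)%N) (kl : (k <= l)%N).
Variables (g f : nat -> nat) (pg : pbw k g) (pf : pbw l f).
Hypothesis viol : forall q, (a <= q < l)%N -> (f q < g a)%N.

(** If [g a] were below [l], the entry of [f] in row [g a] would be smaller than [g a] by [viol],
    hence below [l], and (i) would force it to equal [g a]. *)
Lemma viol_ge : (l <= g a)%N.
Proof.
have [g1 g2] := pg; have [f1 f2] := pf; rewrite leqNgt; apply/negP => lt.
have ag : (a <= g a)%N by case: (ltnP (g a) k) => [/(g1 _ ak) ->|]; lia.
have v : (f (g a) < g a)%N by apply: viol; rewrite ag.
by move: (v); rewrite f1 ?ltnn //; apply: ltn_trans lt.
Qed.

Lemma viol_disj r : (r <= a)%N -> ~~ (k <= g r < l)%N.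
Proof.
have [g1 g2] := pg; have h := viol_ge => ra.
have [->|ne] := eqVneq r a; first by lia.
have [->|/eqP ne'] := eqVneq (g r) r; first by lia.
by have := g2 r a _ ne'; lia.
Qed.

Lemma garnir_colm (s : 'S_(k + l)) g' : @gar_ok k l a f s -> ~~ gar_pres s ->
  (exists t : 'S_k, g' = permf t (gar_g g f s)) -> pbw k g' ->
  (forall r, (r < k)%N -> (g' r < N)%N) ->
  (colm N k g' < colm N k g)%N.
Proof.
move=> sok np [t et] pg' g'N; have la := viol_ge.
have [g1 g2] := pg; have [f1 f2] := pf.
have ga r : (a < r < k)%N -> (a < g r < g a)%N.
  move=> ar; have : (g r < g a)%N by apply: g2 => //; lia.
  have rk : (r < k)%N by lia.
  by case: (ltnP (g r) k) => [/(g1 _ rk)|]; lia.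
have pa : prof k g a = g a.
  apply/eqP; rewrite eqn_leq leq_prof ?leqnn // andbT; apply/prof_leP => q aq.
  by have [<-//|ne] := eqVneq a q; apply: ltnW; have /ga/andP[] : (a < q < k)%N by lia.
apply: (lex_lt ak); first by move=> p pk; apply: prof_ltN.
- move=> p ap; have pk : (p < k)%N by lia.
  apply: prof_of_cnt => //.
    rewrite pk /=; have : (k.-1 <= prof k g p)%N; last by lia.
    apply: leq_trans (leq_prof g (_ : (p <= k.-1 < k)%N)); last by lia.
    by have kk : (k.-1 < k)%N by [lia]; case: (ltnP (g k.-1) k) => [/(g1 _ kk)|]; lia.
  rewrite et cnt_permf; apply: leq_trans (cnt_prof pg pk) _.
  apply: (cnt_gar_ge sok) => // r rk /andP[pr rp].
  rewrite ltnNge; apply/negP => ra.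
  have lt : (prof k g p < g a)%N.
    have := ga _ ap; case E : (g a) => [|m]; rewrite ?ltn0 ?andbF // => _.
    rewrite ltnS; apply/prof_leP => q pq.
    by have /ga : (a < q < k)%N by [lia]; lia.
  have [e|/eqP ne] := eqVneq (g r) r; first by lia.
  have [e|ne'] := eqVneq r a; first by rewrite e in rp; lia.
  by have := g2 r a _ ne; lia.
(* With [m = g a - 1], the values in [a..m] include those of [g] after row [a] and, by [viol], those
   of [f] from row [a] on; [cnt_gar_gt] then bounds the new profile at [a] by [m]. *)
- rewrite pa; case E : (g a) => [|m]; first by lia.
  rewrite ltnS; apply: prof_of_cnt => //; first by lia.
  rewrite et cnt_permf; apply: (cnt_gar_gt ak kl sok) => // [r /ga|i ai]; first by lia.
  have := viol ai; have il : (i < l)%N by lia.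
  by case: (ltnP (f i) l) => [/(f1 _ il)|]; lia.
Qed.

End GarnirStep.

(** * Straightening with respect to condition (iv) *)

Section Table.
Variables (n N : nat) (N0 : (0 < N)%N) (L : nat) (kap : nat -> nat).
Hypothesis kapn : forall j, (j < L)%N -> (kap j <= n)%N.

Definition table := {ffun 'I_n * 'I_L -> 'I_N}.

Definition cell (T : table) j r : nat :=
  if insub r is Some r' then if insub j is Some j' then val (T (r', j')) else 0%N else 0%N.

Lemma cellE (T : table) (r : 'I_n) (j : 'I_L) : cell T j r = T (r, j).
Proof. by rewrite /cell !valK. Qed.

Definition canon (T : table) : Prop :=
  forall (r : 'I_n) (j : 'I_L), (kap j <= r)%N -> T (r, j) = 0%N :> nat.

Definition tabulate (G : nat -> nat -> nat) : table :=
  [ffun rj : 'I_n * 'I_L => if (rj.1 < kap rj.2)%N then insubd (Ordinal N0) (G rj.2 rj.1) else Ordinal N0].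

Definition agree (G G' : nat -> nat -> nat) :=
  forall j, (j < L)%N -> forall r, (r < kap j)%N -> G j r = G' j r.

Definition inrange (G : nat -> nat -> nat) :=
  forall j, (j < L)%N -> forall r, (r < kap j)%N -> (G j r < N)%N.

Lemma canon_tabulate G : canon (tabulate G).
Proof. by move=> r j; rewrite ffunE /= ltnNge => ->. Qed.

Lemma cell_tabulate G : inrange G -> agree G (cell (tabulate G)).
Proof.
move=> GN j jL r rk; have rn := leq_trans rk (kapn jL).
rewrite -[r]/(val (Ordinal rn)) -[j]/(val (Ordinal jL)) cellE ffunE /= rk.
by rewrite val_insubd GN.
Qed.

Lemma cell_ltN T j r : (cell T j r < N)%N.
Proof. by rewrite /cell; case: (insub r) => [r'|] //; case: (insub j) => [j'|] //=; rewrite ltn_ord. Qed.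

Lemma agree_canon T T' : canon T -> canon T' -> agree (cell T) (cell T') -> T = T'.
Proof.
move=> cT cT' e; apply/ffunP => -[r j]; apply: val_inj => /=.
case: (ltnP r (kap j)) => [rk|kr]; last by rewrite cT // cT'.
by rewrite -!cellE e.
Qed.

(** Conditions (i), (ii) and (iv), without (iii). *)
Definition stdA (G : nat -> nat -> nat) : Prop :=
  (forall j, (j < L)%N -> pbw (kap j) (G j)) /\
  (forall j, (j.+1 < L)%N -> forall r, (r < kap j.+1)%N ->
     exists2 q, (r <= q < kap j)%N & (G j.+1 r <= G j q)%N).

Lemma eq_stdA G G' : agree G G' -> stdA G -> stdA G'.
Proof.
move=> e [G1 G2]; split=> [j jL|j jL r rk].
  by apply: eq_pbw (G1 j jL) => r; apply: e.
have [q rq le] := G2 j jL r rk; exists q => //.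
by rewrite -!e //; [exact: ltnW|case/andP: rq].
Qed.

Definition tstdA (T : table) : Prop := canon T /\ stdA (cell T).

Variable K : fieldType.

Definition mon (G : nat -> nat -> nat) (P : nat -> nat -> nat -> K) : K :=
  \prod_(j < L) minor (kap j) (P (kap j)) (G j).

Lemma eq_mon G G' P : agree G G' -> mon G P = mon G' P.
Proof. by move=> e; apply: eq_bigr => j _; apply: eq_minor => r; apply: e. Qed.

Lemma mon_sort G : inrange G ->
  (forall P, mon G P = 0) \/
  exists G', exists e : K, [/\ forall P, mon G P = e * mon G' P,
    forall j, (j < L)%N -> pbw (kap j) (G' j) & inrange G'].
Proof.
move=> GN; case: (boolP [forall j : 'I_L, injectiveb (fun r : 'I_(kap j) => G j r)]).
  move=> /forallP inj; right.
  have H (j : 'I_L) : exists s : 'S_(kap j), pbw (kap j) (permf s (G j)).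
    by apply: pbw_sort; apply/injectiveP; apply: inj.
  have [s sP] := fin_all_exists H.
  pose G' j := if insub j is Some j' then permf (s j') (G j') else G j.
  have G'E (j : 'I_L) : G' j = permf (s j) (G j) by rewrite /G' valK.
  exists G', (\prod_(j < L) (-1) ^+ s j); split.
  - move=> P; rewrite /mon -big_split; apply: eq_bigr => j _ /=.
    by rewrite G'E minor_permf mulrA -expr2 sqrr_sign mul1r.
  - by move=> j jL; have := sP (Ordinal jL); rewrite -G'E.
  - move=> j jL r rk; rewrite (G'E (Ordinal jL)) -[r]/(val (Ordinal rk)).
    by rewrite permfE; apply: GN.
move=> /forallPn[j /injectivePn[r [q rq e]]]; left => P.
by rewrite /mon (bigD1 j) //= (minor_dup _ rq e) mul0r.
Qed.

(** The inclusion of [pr_(k+1) U_k] in [U_(k+1)], expressed on spanning columns; coordinate [k + 1]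
    counted from 1 is row [k] here. *)
Definition incidence (P : nat -> nat -> nat -> K) := forall k, (0 < k < n)%N ->
  exists Y : nat -> nat -> K, forall t c, (c < k)%N ->
    (if t == k then 0 else P k t c) = \sum_(d < k.+1) P k.+1 t d * Y d c.

Lemma incidence_trans P k l : incidence P -> (0 < k <= l)%N -> (l <= n)%N ->
  exists Y : nat -> nat -> K, forall t c, (c < k)%N ->
    (if (k <= t < l)%N then 0 else P k t c) = \sum_(d < l) P l t d * Y d c.
Proof.
move=> VP /andP[k0]; elim: l => [|l IH]; first by lia.
rewrite leq_eqVlt => /orP[/eqP <- _|kl ln].
  exists (fun d c => (d == c)%:R) => t c ck.
  rewrite (bigD1 (Ordinal ck)) //= eqxx mulr1 big1 ?addr0; first by case: ifP => //; lia.
  by move=> d; rewrite -val_eqE /= => /negPf ->; rewrite mulr0.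
have [Y1 Y1E] := IH kl (ltnW ln).
have l0 : (0 < l < n)%N by lia.
have [Y2 Y2E] := VP l l0.
exists (fun d c => \sum_(d' < l) Y2 d d' * Y1 d' c) => t c ck.
have -> : (if (k <= t < l.+1)%N then 0 else P k t c) =
  (if t == l then 0 else if (k <= t < l)%N then 0 else P k t c).
  have [->|ne] := eqVneq t l; first by rewrite -ltnS kl ltnSn.
  by rewrite (_ : (k <= t < l.+1)%N = (k <= t < l)%N) //; lia.
rewrite (Y1E t c ck).
transitivity (\sum_(d' < l) (\sum_(d < l.+1) P l.+1 t d * Y2 d d') * Y1 d' c).
  rewrite [RHS](eq_bigr (fun d' : 'I_l => (if t == l then 0 else P l t d') * Y1 d' c)); last first.
    by move=> d' _; rewrite (Y2E t d').
  by case: ifP => // _; rewrite big1 // => d' _; rewrite mul0r.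
rewrite (eq_bigr (fun d' : 'I_l => \sum_(d < l.+1) P l.+1 t d * Y2 d d' * Y1 d' c)); last first.
  by move=> d' _; rewrite mulr_suml.
rewrite exchange_big; apply: eq_bigr => d _ /=.
by rewrite mulr_sumr; apply: eq_bigr => d' _; rewrite mulrA.
Qed.

(** A Garnir step lowers the right-hand column of a pair but may raise the left-hand one, so columns
    further to the right are more significant. The base [N ^ n] bounds the measure of one column. *)
Definition totm (G : nat -> nat -> nat) :=
  (\sum_(j < L) colm N (kap j) (G j) * (N ^ n) ^ j)%N.

Definition upd2 (G : nat -> nat -> nat) j (f g : nat -> nat) i :=
  if i == j then f else if i == j.+1 then g else G i.

Lemma mon_upd2 G j : (j.+1 < L)%N -> exists R : (nat -> nat -> nat -> K) -> K,
  forall f g P, mon (upd2 G j f g) P =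
    R P * (minor (kap j.+1) (P (kap j.+1)) g * minor (kap j) (P (kap j)) f).
Proof.
move=> jL; pose j0 := Ordinal (ltnW jL); pose j1 := Ordinal jL.
exists (fun P => \prod_(i < L | (i != j1) && (i != j0)) minor (kap i) (P (kap i)) (G i)).
move=> f g P; rewrite /mon (bigD1 j1) //= (bigD1 j0) /=; last first.
  by rewrite -val_eqE /= ltn_eqF.
rewrite /upd2 /= eqxx (gtn_eqF (ltnSn j)) eqxx mulrA mulrC; congr (_ * _).
apply: eq_bigr => i /andP[]; rewrite -!val_eqE /= => /negPf h1 /negPf h2.
by rewrite h1 h2.
Qed.

Hypothesis K0 : forall m, m.+1%:R != 0 :> K.
Hypothesis kap_dec : forall j, (j.+1 < L)%N -> (kap j.+1 <= kap j)%N.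

Lemma straighten_pbw G : (forall j, (j < L)%N -> pbw (kap j) (G j)) -> inrange G ->
  inspan incidence (fun T => mon (cell T)) tstdA (mon G).
Proof.
have [m] := ubnP (totm G); elim: m G => // m IH G Gm pG GN.
case: (boolP [forall j : 'I_L, forall r : 'I_(kap j.+1), (j.+1 < L)%N ==>
   [exists q : 'I_(kap j), (r <= q)%N && (G j.+1 r <= G j q)%N]]).
  move=> /forallP H.
  have e := cell_tabulate GN.
  apply: (inspan_ext (p' := mon (cell (tabulate G)))) => [P _|]; first exact: eq_mon.
  apply: (@inspan_gen _ _ _ _ (fun T => mon (cell T))); split; first exact: canon_tabulate.
  apply: (eq_stdA e); split=> // j jL r rk.
  have /forallP/(_ (Ordinal rk))/implyP/(_ jL)/existsP[q /andP[rq le]] := H (Ordinal (ltnW jL)).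
  by exists q => //; rewrite rq ltn_ord.
move=> /forallPn[j /forallPn[r]]; rewrite negb_imply => /andP[jL /existsPn viol'].
set k := kap j.+1; set l := kap j; set g := G j.+1; set f := G j.
have ak : (r < k)%N := ltn_ord r.
have kl : (k <= l)%N := kap_dec jL.
have pg : pbw k g := pG _ jL.
have pf : pbw l f := pG _ (ltnW jL).
have viol q : (r <= q < l)%N -> (f q < g r)%N.
  move=> /andP[rq ql]; have := viol' (Ordinal ql); rewrite rq /=.
  by rewrite -ltnNge.
have disj := viol_disj ak kl pg pf viol.
have c0 := gar_pres_gt0 k l; set c := #|_| in c0.
have cn0 : c%:R != 0 :> K by case: c c0.
have [R RE] := mon_upd2 G jL.
have GE P : mon G P = mon (upd2 G j f g) P.
  by apply: eq_mon => i _ q _; rewrite /upd2; case: eqP => [->//|_]; case: eqP => [->|].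
apply: (inspan_ext (p' := fun P => c%:R^-1 * (-1) *
   \sum_(s : 'S_(k + l) | gar_ok r f s && ~~ gar_pres s)
     (-1) ^+ s * (R P * (minor k (P k) (gar_g g f s) * minor l (P l) (gar_f g f s))))).
  move=> P VP; rewrite GE RE.
  have [|Y YE] := @incidence_trans P k l VP _ (kapn (ltnW jL)); first by lia.
  rewrite -[LHS](mulKf cn0) -mulrA; congr (_ * _).
  rewrite mulrCA (garnir ak kl f YE disj) mulrN mulN1r; congr (- _).
  by rewrite mulr_sumr; apply: eq_bigr => s _; rewrite mulrCA.
apply: inspanZ; apply: inspan_sum => s /andP[sok np].
apply: inspanZ.
have [z|/pbw_sort[tg ptg]] := minor_injP K k (gar_g g f s).
  by apply: inspan0 => P _; rewrite z mul0r mulr0.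
have [z|/pbw_sort[tf ptf]] := minor_injP K l (gar_f g f s).
  by apply: inspan0 => P _; rewrite z !mulr0.
set G' := upd2 G j (permf tf (gar_f g f s)) (permf tg (gar_g g f s)).
have hN (x : 'I_(k + l)) : (gar_h g f x < N)%N.
  rewrite /gar_h; case: ifP => xk; first exact: (GN j.+1 jL x xk).
  by apply: (GN j (ltnW jL)); have := ltn_ord x; rewrite -/l; lia.
have gN q : (q < k)%N -> (permf tg (gar_g g f s) q < N)%N.
  by move=> qk; rewrite -[q]/(val (Ordinal qk)) permfE gar_gE.
have fN q : (q < l)%N -> (permf tf (gar_f g f s) q < N)%N.
  by move=> qk; rewrite -[q]/(val (Ordinal qk)) permfE gar_fE.
apply: (inspan_ext (p' := fun P => (-1) ^+ tg * (-1) ^+ tf * mon G' P)).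
  move=> P _; rewrite RE !minor_permf [RHS]mulrCA; congr (_ * _).
  rewrite [X in _ = _ * X]mulrACA [RHS]mulrA.
  by rewrite [X in _ = X * _]mulrACA -!expr2 !sqrr_sign !mul1r.
apply: inspanZ; apply: IH.
- suff : (totm G' < totm G)%N by lia.
  apply: (lex_lt (u := fun i => colm N (kap i) (G' i)) (v := fun i => colm N (kap i) (G i)) jL).
  + move=> i iL; apply: (@leq_trans (N ^ kap i)); last by rewrite leq_pexp2l // kapn.
    apply: base_lt => p pk; apply: prof_ltN => // q qk; rewrite /G' /upd2.
    case: eqP => [e|_]; first by apply: fN; rewrite /l -e.
    by case: eqP => [e|_]; [apply: gN; rewrite /k -e | apply: GN].
  + move=> i ji; rewrite /G' /upd2 !gtn_eqF //; lia.
  + rewrite /G' /upd2 eqxx gtn_eqF //.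
    by apply: (garnir_colm ak kl pg pf viol sok np) => //; exists tg.
- move=> i iL; rewrite /G' /upd2; case: eqP => [->//|_].
  by case: eqP => [->//|_]; apply: pG.
- move=> i iL q; rewrite /G' /upd2; case: eqP => [->|_]; first exact: fN.
  by case: eqP => [->|_]; [exact: gN | exact: GN].
Qed.

Theorem straighten G : inrange G -> inspan incidence (fun T => mon (cell T)) tstdA (mon G).
Proof.
move=> GN; have [z|[G' [e [eE pG' G'N]]]] := mon_sort GN; first exact: inspan0.
apply: (inspan_ext (p' := fun P => e * mon G' P)) => [P _//|].
by apply: inspanZ; apply: straighten_pbw.
Qed.

End Table.

(** * Isotropy relations and the straightening of one column *)

Section IsotropyRelation.
Variables (K : fieldType) (N k : nat).
Hypothesis K2 : (2%:R : K) != 0.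

(** The form on the projections [pr13] of columns [p] and [q]: only the pairs [t, N.-1 - t] with
    [t < k] survive. *)
Definition isotropic (M : nat -> nat -> K) := forall p q, (p < k)%N -> (q < k)%N ->
  \sum_(t < k) (M t p * M (N.-1 - t)%N q - M (N.-1 - t)%N p * M t q) = 0.

Lemma det_row_expand m (R : 'I_m -> 'I_m -> K) (u : 'I_m) (x : 'I_m -> K) :
  \det (\matrix_(r, c) if r == u then x c else R r c) =
  \sum_p x p * \det (\matrix_(r, c) if r == u then (p == c)%:R else R r c).
Proof.
rewrite (expand_det_row _ u); apply: eq_bigr => p _; rewrite mxE eqxx; congr (_ * _).
rewrite (expand_det_row _ u) (bigD1 p) //= mxE !eqxx mul1r big1 ?addr0.
  congr (_ * \det _); apply/matrixP => r c; rewrite !mxE.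
  by rewrite eq_sym (negPf (neq_lift _ _)).
by move=> c cp; rewrite mxE eqxx eq_sym (negPf cp) mul0r.
Qed.

Variables (M : nat -> nat -> K) (Miso : isotropic M).

(** Expanding rows [u] and [v] gives the sum of [S p q * E p q], where [S] is symmetric by isotropy
    and [E] changes sign when [p] and [q] are exchanged. The sum is therefore its own negative. *)
Lemma isotropy_rel f (u v : 'I_k) : u != v ->
  \sum_(t < k) minor k M (fun r => if r == u then t : nat else if r == v then (N.-1 - t)%N else f r) = 0.
Proof.
move=> uv.
pose E (p q : 'I_k) := \det (\matrix_(r < k, c < k)
   if r == u then (p == c)%:R else if r == v then (q == c)%:R else M (f r) c).
have EN p q : E q p = - E p q.
  rewrite /E; set Z := (X in _ = - \det X).
  have -> : - \det Z = \det (row_perm (tperm u v) Z).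
    by rewrite row_permE det_mulmx det_perm odd_tperm uv expr1 mulN1r.
  congr (\det _); apply/matrixP => r c; rewrite !mxE.
  case: tpermP => [->|->|/eqP ru /eqP rv]; rewrite ?eqxx //.
  - by rewrite (eq_sym v u) (negPf uv).
  - by rewrite (eq_sym v u) (negPf uv).
  - by rewrite (negPf ru) (negPf rv).
pose S (p q : 'I_k) := \sum_(t < k) M t p * M (N.-1 - t)%N q.
have SC p q : S p q = S q p.
  have /eqP := Miso (ltn_ord p) (ltn_ord q); rewrite big_split /= sumrN subr_eq0 => /eqP.
  by rewrite -/(S p q) => ->; apply: eq_bigr => t _; rewrite mulrC.
have DE (t : 'I_k) : minor k M (fun r => if r == u then t : nat else if r == v then (N.-1 - t)%N else f r)
   = \sum_(p < k) \sum_(q < k) M t p * M (N.-1 - t)%N q * E p q.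
  transitivity (\det (\matrix_(r < k, c < k) if r == u then M t c else
       if r == v then M (N.-1 - t)%N c else M (f r) c)).
    congr (\det _); apply/matrixP => r c; rewrite !mxE -!val_eqE /=.
    by case: ifP => // _; case: ifP.
  rewrite det_row_expand; apply: eq_bigr => p _.
  transitivity (M t p * \det (\matrix_(r < k, c < k) if r == v then M (N.-1 - t)%N c else
       if r == u then (p == c)%:R else M (f r) c)).
    congr (_ * \det _); apply/matrixP => r c; rewrite !mxE.
    by case: (eqVneq r v) => [->|//]; rewrite (eq_sym v u) (negPf uv).
  rewrite det_row_expand mulr_sumr; apply: eq_bigr => q _; rewrite mulrA; congr (_ * \det _).
  apply/matrixP => r c; rewrite !mxE.
  by case: (eqVneq r v) => [->|//]; rewrite (eq_sym v u) (negPf uv).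
set X := \sum_(t < k) _.
have XE : X = \sum_(p < k) \sum_(q < k) S p q * E p q.
  rewrite /X (eq_bigr _ (fun t _ => DE t)) exchange_big; apply: eq_bigr => p _ /=.
  by rewrite exchange_big; apply: eq_bigr => q _ /=; rewrite mulr_suml.
have : X = - X.
  rewrite {1}XE exchange_big XE -sumrN; apply: eq_bigr => p _ /=.
  by rewrite -sumrN; apply: eq_bigr => q _; rewrite EN SC mulrN.
move/eqP; rewrite -addr_eq0 -mulr2n -mulr_natl mulf_eq0 (negPf K2) /=.
by move/eqP.
Qed.

End IsotropyRelation.

Section Substitution.
Variables (n N k : nat) (N2 : N = (2 * n)%N) (kn : (k <= n)%N).
Variables (f : nat -> nat) (finj : injective (fun r : 'I_k => f r)).
Hypothesis fN : forall r, (r < k)%N -> (f r < N)%N.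

Definition hits (f : nat -> nat) x := [exists r : 'I_k, f r == x].

Variables (A : {set 'I_k}).
Hypothesis Ahit : forall a, a \in A -> hits f a /\ hits f (N.-1 - a)%N.

(* Sends each pair [a, bar a] with [a] in [A] to the pair [t a, bar (t a)]. *)
Definition subst (t : 'I_k -> 'I_k) (x : nat) : nat :=
  if insub x is Some a then if a \in A then t a : nat else x
  else if insub (N.-1 - x)%N is Some a then if a \in A then (N.-1 - t a)%N else x else x.

Lemma substA t (a : 'I_k) : a \in A -> subst t a = t a.
Proof. by move=> aA; rewrite /subst valK aA. Qed.

Lemma substB t (a : 'I_k) : a \in A -> subst t (N.-1 - a)%N = (N.-1 - t a)%N.
Proof.
move=> aA; have ak := ltn_ord a; rewrite /subst insubF; last by lia.
by rewrite (_ : N.-1 - (N.-1 - a) = a)%N ?valK ?aA //; lia.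
Qed.

Lemma substCA t (a : 'I_k) : a \notin A -> subst t a = a.
Proof. by move=> aA; rewrite /subst valK (negPf aA). Qed.

Lemma substCB t (a : 'I_k) : a \notin A -> subst t (N.-1 - a)%N = (N.-1 - a)%N.
Proof.
move=> aA; have ak := ltn_ord a; rewrite /subst insubF; last by lia.
by rewrite (_ : N.-1 - (N.-1 - a) = a)%N ?valK ?(negPf aA) //; lia.
Qed.

Lemma subst_ltN t x : (x < N)%N -> (subst t x < N)%N.
Proof.
move=> xN; have H (a : 'I_k) : (a < N)%N by have := ltn_ord a; lia.
rewrite /subst; case: insubP => [a _ ea|_]; first by case: ifP.
by case: insubP => [a _ ea|//]; case: ifP => // _; have := H (t a); lia.
Qed.

Lemma eq_subst t t' x : (forall a, a \in A -> (x == a :> nat) || (x == N.-1 - a)%N -> (x < N)%N -> t a = t' a) ->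
  (x < N)%N -> subst t x = subst t' x.
Proof.
move=> e xN; rewrite /subst; case: insubP => [a _ ea|_].
  by case: ifP => // aA; rewrite e // ea eqxx.
case: insubP => [a _ ea|//]; case: ifP => // aA; rewrite e //.
by apply/orP; right; apply/eqP; rewrite ea; lia.
Qed.

Lemma hitsP (g : nat -> nat) x : reflect (exists r : 'I_k, g r = x) (hits g x).
Proof. by apply: (iffP existsP) => -[r /eqP]; exists r => //; apply/eqP. Qed.

Variable K : fieldType.
Implicit Types M : nat -> nat -> K.

Definition smin t M := minor k M (fun r => subst t (f r)).

Lemma smin_dup t M a a' : a \in A -> a' \in A -> a != a' -> t a = t a' -> smin t M = 0.
Proof.
move=> aA a'A ne e; have [/hitsP[r er] _] := Ahit aA; have [/hitsP[r' er'] _] := Ahit a'A.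
apply: (@minor_dup _ _ _ _ r r'); last by rewrite er er' !substA // e.
by apply: contraNneq ne => e'; apply/eqP/val_inj; rewrite /= -er -er' e'.
Qed.

Lemma smin_hit t M a z : a \in A -> z \notin A -> t a = z ->
  hits f z || hits f (N.-1 - z)%N -> smin t M = 0.
Proof.
move=> aA zA taz; have [/hitsP[r er] /hitsP[r' er']] := Ahit aA.
have az : a != z by apply: contraNneq zA => <-.
have ak := ltn_ord a; have zk := ltn_ord z.
have az' : a <> z :> nat by move/val_inj => e; rewrite e eqxx in az.
case/orP => /hitsP[q eq].
  apply: (@minor_dup _ _ _ _ r q); last by rewrite er eq substA // substCA // taz.
  by apply/eqP => e; rewrite e in er; lia.
apply: (@minor_dup _ _ _ _ r' q); last by rewrite er' eq substB // substCB // taz.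
by apply/eqP => e; rewrite e in er'; lia.
Qed.

(** Exchanging two pairs is a product of two transpositions of rows, hence even: pairs behave like
    commuting 2-vectors in the exterior algebra. *)
Lemma smin_swap t M a a' : a \in A -> a' \in A -> a != a' ->
  smin (fun x => t (tperm a a' x)) M = smin t M.
Proof.
move=> aA a'A ne.
have [/hitsP[ra ea] /hitsP[rb eb]] := Ahit aA.
have [/hitsP[ra' ea'] /hitsP[rb' eb']] := Ahit a'A.
have ak := ltn_ord a; have a'k := ltn_ord a'.
have ne' : a <> a' :> nat by move/val_inj => e; rewrite e eqxx in ne.
have D r r' : f r <> f r' -> r <> r' by move=> H e; rewrite e in H.
have raa : ra <> ra' by move=> e; rewrite e in ea; lia.
have rab : ra <> rb by move=> e; rewrite e in ea; lia.
have rab' : ra <> rb' by move=> e; rewrite e in ea; lia.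
have ra'b : ra' <> rb by move=> e; rewrite e in ea'; lia.
have ra'b' : ra' <> rb' by move=> e; rewrite e in ea'; lia.
have rbb : rb <> rb' by move=> e; rewrite e in eb; lia.
pose s := (tperm ra ra' * tperm rb rb')%g.
have -> : smin t M = minor k M (permf s (fun r => subst t (f r))).
  rewrite minor_permf odd_permM !odd_tperm.
  by move/eqP: raa => ->; move/eqP: rbb => ->; rewrite mul1r.
apply: eq_minor => r rk; rewrite -[r]/(val (Ordinal rk)) permfE permM.
move: (Ordinal rk) => {r rk} r /=.
case: (tpermP ra ra' r) => [->|->|/eqP nra /eqP nra'].
- by rewrite tpermD; [rewrite ea ea' !substA // tpermL | apply/eqP; auto..].
- by rewrite tpermD; [rewrite ea ea' !substA // tpermR | apply/eqP; auto..].
case: tpermP => [->|->|/eqP nrb /eqP nrb'].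
- by rewrite eb eb' !substB // tpermL.
- by rewrite eb eb' !substB // tpermR.
apply: eq_subst; last exact: fN.
move=> x xA xr fr; rewrite tpermD //.
- apply/eqP => e; case/orP: xr => /eqP h.
    by move/eqP: nra; apply; apply: finj; rewrite /= h -e ea.
  by move/eqP: nrb; apply; apply: finj; rewrite /= h -e eb.
- apply/eqP => e; case/orP: xr => /eqP h.
    by move/eqP: nra'; apply; apply: finj; rewrite /= h -e ea'.
  by move/eqP: nrb'; apply; apply: finj; rewrite /= h -e eb'.
Qed.

Lemma smin_perm (s : 'S_k) M : (forall x, x \notin A -> s x = x) -> smin s M = minor k M f.
Proof.
have [m] := ubnP #|[set x | s x != x]|; elim: m s => // m IH s sm sA.
have [e|/set0Pn[x]] := eqVneq [set x | s x != x] set0.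
  apply: eq_minor => r rk; have fr := fN rk.
  have sid x : s x = x by apply/eqP; have := in_set0 x; rewrite -e inE => /negbFE.
  rewrite /subst; case: insubP => [a _ ea|_]; first by rewrite sid ea if_same.
  by case: insubP => [a _ ea|//]; case: ifP => // _; rewrite sid ea; lia.
rewrite inE => sx; pose x' := s^-1%g x.
have sx' : s x' = x by rewrite permKV.
have xx' : x != x' by apply: contraNneq sx => e; rewrite {1}e sx'.
have xA : x \in A by apply: contraNT sx => /sA ->.
have x'A : x' \in A by apply: contraNT xx' => /sA; rewrite sx' => ->.
rewrite -(IH (tperm x x' * s)%g).
- rewrite -(smin_swap s M xA x'A xx'); apply: eq_minor => r rk.
  by apply: eq_subst => [a _ _ _|]; [rewrite permM | apply: fN].
- rewrite -ltnS; apply: leq_trans sm; rewrite ltnS; apply: proper_card; apply/properP; split.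
    apply/subsetP => z; rewrite !inE permM; case: tpermP => [->|->|//].
      by rewrite sx' eqxx.
    by rewrite sx'.
  by exists x; rewrite inE // permM tpermL sx' eqxx.
- move=> z zA; rewrite permM tpermD ?sA //.
    by apply: contraNneq zA => <-.
  by apply: contraNneq zA => <-.
Qed.

Hypothesis K2 : (2%:R : K) != 0.

Definition fupd (t : {ffun 'I_k -> 'I_k}) s x : {ffun 'I_k -> 'I_k} :=
  [ffun a => if a == s then x else t a].

Lemma smin_isotropic (t : {ffun 'I_k -> 'I_k}) M s : isotropic N k M -> s \in A ->
  \sum_(x < k) smin (fupd t s x) M = 0.
Proof.
move=> Miso sA; have [/hitsP[r er] /hitsP[r' er']] := Ahit sA.
have sk := ltn_ord s.
have rr : r != r' by apply/eqP => e; rewrite e in er; lia.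
rewrite -[RHS](isotropy_rel K2 Miso (fun r => subst t (f r)) rr).
apply: eq_bigr => x _; apply: eq_minor => q qk.
have [->|nq] := eqVneq q r; first by rewrite er substA // ffunE eqxx.
have [->|nq'] := eqVneq q r'; first by rewrite er' substB // ffunE eqxx.
apply: eq_subst; last exact: fN.
move=> a aA qa fq; rewrite ffunE; case: eqP => // e; exfalso.
case/orP: qa => /eqP h.
  move/eqP: nq; apply; rewrite -[q]/(val (Ordinal qk)); congr val.
  by apply: finj; rewrite /= h e er.
move/eqP: nq'; apply; rewrite -[q]/(val (Ordinal qk)); congr val.
by apply: finj; rewrite /= h e er'.
Qed.

End Substitution.

Definition paired N k (f : nat -> nat) x := hits k f x && hits k f (N.-1 - x)%N.

(** The set of pairs read as a binary number: gaining a pair of larger index outweighs losing any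
    pairs of smaller index. *)
Definition pmeas N k f := (\sum_(x < k | paired N k f x) 2 ^ x)%N.

Lemma sum_pow2 m : (\sum_(x < m) 2 ^ x < 2 ^ m)%N.
Proof. by have := @base_lt 2 m (fun=> 1%N) (fun _ _ => isT); under eq_bigr do rewrite mul1n. Qed.

Lemma pmeas_lt N k f g (i : nat) (z : 'I_k) : (i < z)%N -> ~~ paired N k f z -> paired N k g z ->
  (forall x : 'I_k, (i < x)%N -> paired N k f x -> paired N k g x) ->
  (pmeas N k f < pmeas N k g)%N.
Proof.
move=> iz nfz gz fg; rewrite /pmeas.
rewrite [X in (X < _)%N](bigID (fun x : 'I_k => i < x)%N) /=.
have small : (\sum_(x < k | paired N k f x && ~~ (i < x)) 2 ^ x < 2 ^ z)%N.
  apply: leq_ltn_trans (sum_pow2 z).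
  rewrite (big_ord_widen k (fun x => 2 ^ x)%N (ltnW (ltn_ord z))).
  rewrite big_mkcond [X in (_ <= X)%N]big_mkcond; apply: leq_sum => x _.
  by case: ifP => // /andP[_ xi]; rewrite (_ : (x < z)%N) //; lia.
rewrite [X in (_ < X)%N](bigD1 z) //= [X in (X < _)%N]addnC -addSn; apply: leq_add => //.
rewrite big_mkcond [X in (_ <= X)%N]big_mkcond; apply: leq_sum => x _.
case: ifP => // /andP[fx ix]; rewrite fg // ifT //=.
by apply: contraNneq nfz => <-.
Qed.

Section IsotropicStep.
Variables (K : fieldType) (K0 : forall m, m.+1%:R != 0 :> K).
Variables (n N k : nat) (N2 : N = (2 * n)%N) (kn : (k <= n)%N).
Variables (f : nat -> nat) (finj : injective (fun r : 'I_k => f r)).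
Hypothesis fN : forall r, (r < k)%N -> (f r < N)%N.
Variable (i : nat).

Let A := [set a : 'I_k | (a <= i)%N && paired N k f a].
Let B := [set b : 'I_k | (b <= i)%N && ~~ (hits k f b || hits k f (N.-1 - b)%N)].

Hypothesis BA : (#|B| < #|A|)%N.

Variables (Pt : Type) (I : finType) (V : Pt -> Prop) (X : I -> Pt -> K) (Q : I -> Prop).
Variables (M : Pt -> nat -> nat -> K) (VM : forall P, V P -> isotropic N k (M P)).
Hypothesis IH : forall g, (forall r, (r < k)%N -> (g r < N)%N) ->
  (pmeas N k f < pmeas N k g)%N -> inspan V X Q (fun P => minor k (M P) g).

Let Ahit a : a \in A -> hits k f a /\ hits k f (N.-1 - a)%N.
Proof. by rewrite inE => /andP[_ /andP[]]. Qed.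

Let y (t : {ffun 'I_k -> 'I_k}) P := smin N f A t (M P).

Let fam (S : {set 'I_k}) (t : {ffun 'I_k -> 'I_k}) (x : 'I_k) : bool :=
  if x \in A then (if x \in S then t x \in B else t x \in A) else t x == x.

(** Sums the substitutions in which the pairs of [S] move to free places in [B] and the other pairs
    of [A] stay within [A]. Then [h set0] is a positive multiple of the wanted minor, while [h A]
    vanishes because [B] is smaller than [A]. *)
Let h S P := \sum_(t | [forall x, fam S t x]) y t P.

(** The target of [s] is either occupied, which makes two rows equal, or free and beyond [i]; in the
    latter case a pair of larger index appears while all pairs beyond [i] are kept. *)
Lemma rest_span s (t : {ffun 'I_k -> 'I_k}) : s \in A -> t s \notin A -> t s \notin B ->
  (forall a, a \notin A -> t a = a) -> inspan V X Q (y t).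
Proof.
move=> sA tA tB tid.
case: (boolP (hits k f (t s) || hits k f (N.-1 - t s)%N)) => [hit|nhit].
  by apply: inspan0 => P _; apply: (smin_hit N2 kn Ahit _ sA tA).
apply: IH => [r rk|].
  by apply: (subst_ltN N2 kn) => //; apply: fN.
have iz : (i < t s)%N by move: tB; rewrite inE (negPf nhit) andbT -ltnNge.
have [/hitsP[r er] /hitsP[r' er']] := Ahit sA.
apply: (pmeas_lt iz).
- by rewrite negb_and; move: nhit; rewrite negb_or => /andP[->].
- apply/andP; split; apply/hitsP; first by exists r; rewrite er substA.
  by exists r'; rewrite er' (substB N2 kn).
move=> x ix /andP[/hitsP[q eq] /hitsP[q' eq']].
have xA : x \notin A by rewrite inE leqNgt ix.
apply/andP; split; apply/hitsP; first by exists q; rewrite eq substCA.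
by exists q'; rewrite eq' (substCB N2 kn).
Qed.

(** Let the target of [s] vary over all indices: the total vanishes by isotropy, and it splits into
    targets in [A], targets in [B], and targets covered by [rest_span]. *)
Lemma exchange_rel s (S : {set 'I_k}) : s \in A -> s \notin S ->
  inspan V X Q (fun P => h S P + h (s |: S) P).
Proof.
move=> sA sS.
pose fam0 (t : {ffun 'I_k -> 'I_k}) := [forall x, (x == s) || fam S t x].
pose rest := (fun P => \sum_(t | fam0 t && ((t s \notin A) && (t s \notin B))) y t P).
have fam0P t : reflect (forall x, x != s -> fam S t x) (fam0 t).
  apply: (iffP forallP) => H x; first by move=> xs; have := H x; rewrite (negPf xs).
  by case: (eqVneq x s) => //= xs; apply: H.
have tot P : V P -> \sum_(t | fam0 t) y t P = 0.
  (* Substitutions differing only in the target of [s] form one isotropy relation; resetting this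
     target to [s] picks a representative of each group. *)
  move=> VP; rewrite (partition_big (fun t => fupd t s s) (fun t => fam0 t && (t s == s))) /=; last first.
    move=> t /fam0P H; rewrite ffunE eqxx eqxx andbT; apply/fam0P => x xs.
    by have := H x xs; rewrite /fam ffunE (negPf xs).
  rewrite big1 // => t0 /andP[/fam0P t0f /eqP t0s].
  rewrite -[RHS](smin_isotropic N2 kn finj fN Ahit (K0 1) t0 (VM VP) sA).
  rewrite (reindex_onto (fun x => fupd t0 s x) (fun t => t s)) /=; last first.
    move=> t /andP[_ /eqP <-]; apply/ffunP => x; rewrite !ffunE; by case: eqP => [->|].
  apply: eq_bigl => x; rewrite ffunE eqxx eqxx andbT.
  apply/andP; split.
    by apply/fam0P => z zs; have := t0f z zs; rewrite /fam ffunE (negPf zs).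
  apply/eqP/ffunP => z; rewrite !ffunE; case: eqP => [->|_] //.
have AB : forall z, z \in B -> z \notin A.
  by move=> z; rewrite !inE /paired => /andP[_ /norP[/negPf ->]]; rewrite andbF.
have split_tot P : \sum_(t | fam0 t) y t P = h S P + h (s |: S) P + rest P.
  rewrite (bigID (fun t : {ffun 'I_k -> 'I_k} => t s \in A)) /= -addrA; congr (_ + _).
    apply: eq_bigl => t; apply/andP/forallP => [[/fam0P H tA] x|H].
      have [->|/H//] := eqVneq x s; by rewrite /fam sA (negPf sS).
    split; last by have := H s; rewrite /fam sA (negPf sS).
    by apply/fam0P => x _; apply: H.
  rewrite (bigID (fun t : {ffun 'I_k -> 'I_k} => t s \in B)) /=; congr (_ + _); last first.
    by apply: eq_bigl => t; rewrite andbA.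
  apply: eq_bigl => t; apply/andP/forallP => [[/andP[/fam0P H tA] tB] x|H].
    rewrite /fam in_setU1; have [->|xs] := eqVneq x s; first by rewrite sA.
    by have := H x xs; rewrite /fam.
  have tB : t s \in B by have := H s; rewrite /fam in_setU1 eqxx sA.
  split=> //; rewrite AB // andbT; apply/fam0P => x xs.
  by have := H x; rewrite /fam in_setU1 (negPf xs).
apply: (inspan_ext (p' := fun P => -1 * rest P)) => [P VP|].
  by apply/eqP; rewrite mulN1r -addr_eq0 -split_tot tot.
apply: inspanZ; apply: inspan_sum => t /andP[/fam0P tf /andP[tA tB]].
apply: (rest_span sA) => // a aA.
have as_ : a != s by apply: contraNneq aA => ->.
by have := tf a as_; rewrite /fam (negPf aA) => /eqP.
Qed.

(* Moving the elements of [A] one at a time from targets in [A] to targets in [B]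
   changes [h] only by a sign and by terms with larger pair measure; at the end
   there is no injection of [A] into [B]. *)
Lemma h_span (S : {set 'I_k}) : S \subset A -> inspan V X Q (h S).
Proof.
have [m] := ubnP #|A :\: S|; elim: m S => // m IHm S Sm SA.
have [e|/set0Pn[s]] := eqVneq (A :\: S) set0.
  have eS : S = A by apply/eqP; rewrite eqEsubset SA -setD_eq0 e eqxx.
  apply: inspan0 => P _; rewrite /h big1 // => t /forallP tf.
  have tAB a : a \in A -> t a \in B.
    by move=> aA; have := tf a; rewrite /fam aA eS aA.
  have : ~ {in A &, injective t}.
    move=> inj; have := BA; rewrite ltnNge -(card_in_imset inj) => /negP; apply.
    by apply: subset_leq_card; apply/subsetP => z /imsetP[a aA ->]; apply: tAB.
  move=> ninj; case: (boolP [exists a in A, exists b in A, (a != b) && (t a == t b)]).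
    move=> /exists_inP[a aA /exists_inP[b bA /andP[ab /eqP tab]]].
    exact: (smin_dup Ahit (M P) aA bA ab tab).
  move=> /exists_inPn H; case: ninj => a b aA bA tab.
  by have /exists_inPn/(_ b bA) := H a aA; rewrite tab eqxx andbT negbK => /eqP.
rewrite inE => /andP[sS sA].
apply: (inspan_ext (p' := fun P => (h S P + h (s |: S) P) + -1 * h (s |: S) P)).
  by move=> P _; rewrite mulN1r addrK.
apply: inspanD; first exact: exchange_rel.
apply: inspanZ; apply: IHm; last by rewrite subUset sub1set sA.
rewrite -ltnS; apply: leq_trans Sm; rewrite ltnS; apply: proper_card; apply/properP.
split; first by apply: setDS; apply: subsetUr.
by exists s; rewrite in_setD ?in_setU1 ?eqxx // sS.
Qed.

(** In [h set0] the non-injective substitutions vanish and the injective ones permute [A], each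
    contributing the original minor by [smin_perm]. The identity shows that their number [#|C|] is
    not zero. *)
Lemma isotropic_step : inspan V X Q (fun P => minor k (M P) f).
Proof.
pose C := [set t : {ffun 'I_k -> 'I_k} | [forall x, fam set0 t x] && injectiveb t].
have C0 : (0 < #|C|)%N.
  apply/card_gt0P; exists [ffun x => x]; rewrite inE; apply/andP; split.
    by apply/forallP => x; rewrite /fam in_set0 ffunE eqxx; case: ifP.
  by apply/injectiveP => a b; rewrite !ffunE.
apply: (inspan_ext (p' := fun P => (#|C|%:R)^-1 * h set0 P)); last first.
  by apply: inspanZ; apply: h_span; apply: sub0set.
move=> P _; have cn0 : #|C|%:R != 0 :> K by case: #|C| C0.
apply: (mulfI cn0); rewrite mulVKf // /h (bigID (fun t : {ffun 'I_k -> 'I_k} => injectiveb t)) /=.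
rewrite [X in _ + X]big1 ?addr0; last first.
  move=> t /andP[/forallP tf /injectivePn[a [b ab tab]]].
  case: (boolP (a \in A)) => aA; case: (boolP (b \in A)) => bA.
  - exact: (smin_dup Ahit (M P) aA bA ab tab).
  - have := tf a; have := tf b; rewrite /fam aA (negPf bA) in_set0 => /eqP tb.
    by rewrite tab tb (negPf bA).
  - have := tf a; have := tf b; rewrite /fam bA (negPf aA) in_set0 => tb /eqP ta.
    by rewrite -tab ta (negPf aA) in tb.
  have := tf a; have := tf b; rewrite /fam (negPf aA) (negPf bA) => /eqP tb /eqP ta.
  by rewrite -ta tab tb eqxx in ab.
rewrite (eq_bigl (fun t => t \in C)); last by move=> t; rewrite inE.
rewrite (eq_bigr (fun=> minor k (M P) f)); first by rewrite sumr_const mulr_natl.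
move=> t; rewrite inE => /andP[/forallP tf /injectiveP tinj].
rewrite -(smin_perm N2 kn finj fN Ahit (s := perm tinj)).
  apply: eq_minor => r rk; apply: (eq_subst N2 kn); last exact: fN.
  by move=> a _ _ _; rewrite permE.
by move=> a aA; rewrite permE; have := tf a; rewrite /fam (negPf aA) => /eqP.
Qed.

End IsotropicStep.

(* For a PBW-sorted column this is equivalent to condition (iii). *)
Definition admissible N k (f : nat -> nat) := forall r, (r < k)%N -> (f r + r < N)%N.

(** Take the first row [r] with [N <= f r + r] and put [b = N.-1 - f r], so [b < r]. If [f b]
    differed from [b], then (ii) would give [f r < f b], making [b] an earlier such row. *)
Lemma not_admissible N k f : pbw k f -> (forall r, (r < k)%N -> (f r < N)%N) ->
  admissible N k f \/
  exists i r, [/\ (i < r < k)%N, f i = i & f r = (N.-1 - i)%N].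
Proof.
move=> [f1 f2] fN.
case: (boolP [forall r : 'I_k, (f r + r < N)%N]) => [/forallP H|/forallPn[r0 r0N]].
  by left=> r rk; apply: (H (Ordinal rk)).
right; have ex : exists r, (r < k)%N && (N <= f r + r)%N.
  by exists r0; rewrite ltn_ord leqNgt.
case: (ex_minnP ex) => r /andP[rk rN] rmin {ex r0 r0N}.
have frN := fN r rk; set b := (N.-1 - f r)%N.
have br : (b < r)%N by rewrite /b; lia.
exists b, r; split; [by rewrite br| | by rewrite /b; lia].
apply/eqP; apply: contraT => /eqP ne.
have bk := ltn_trans br rk.
have lt : (f r < f b)%N by apply: f2 => //; rewrite br.
by have := rmin b; rewrite bk /=; have := fN b bk; rewrite /b in lt br *; lia.
Qed.

(** Let [U] and [Z] be the indices up to [i] that occur, resp. whose bar occurs. Then [#|A| - #|B|]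
    is [#|U| + #|Z| - i.+1]. An index [x] outside [U] has [f x > N.-1 - i] by (ii), so the bar of
    [f x] is below [i] and lies in [Z]; together with [i] itself this makes [Z] larger than the
    complement of [U]. *)
Lemma card_excess N n k f i r : N = (2 * n)%N -> (k <= n)%N ->
    pbw k f -> (forall r, (r < k)%N -> (f r < N)%N) ->
    (i < r < k)%N -> f i = i -> f r = (N.-1 - i)%N ->
  (#|[set b : 'I_k | (b <= i)%N && ~~ (hits k f b || hits k f (N.-1 - b)%N)]| <
   #|[set a : 'I_k | (a <= i)%N && paired N k f a]|)%N.
Proof.
move=> N2 kn pf fN /andP[ir rk] fi fr; have [f1 f2] := pf.
set B := [set b | _]; set A := [set a | _].
have ik : (i < k)%N by lia.
pose U := [set x : 'I_k | (x <= i)%N && hits k f x].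
pose Z := [set x : 'I_k | (x <= i)%N && hits k f (N.-1 - x)%N].
pose T := [set x : 'I_k | (0 <= x < i.+1)%N].
have cT : #|T| = i.+1 by rewrite card_ord_interval ?subn0.
have UZA : U :&: Z = A.
  by apply/setP => x; rewrite !inE /paired; case: (x <= i)%N.
have UZB : T :\: (U :|: Z) = B.
  by apply/setP => x; rewrite !inE ltnS /=; case: (x <= i)%N; rewrite ?andbT ?andbF.
have sub : U :|: Z \subset T.
  by apply/subsetP => x; rewrite !inE ltnS /=; case: (x <= i)%N.
have cU := cardsUI U Z; rewrite UZA in cU.
have := cardsD T (U :|: Z); rewrite UZB (setIidPr sub) cT => cB.
have UT : U \subset T by apply: subset_trans sub; apply: subsetUl.
have := cardsD T U; rewrite (setIidPr UT) cT => cD.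
have cUT := subset_leq_card UT; have cUZT := subset_leq_card sub.
rewrite cT in cUT cUZT.
pose io := Ordinal ik.
pose psi (x : 'I_k) : 'I_k := insubd x (N.-1 - f x)%N.
have Dprop x : x \in T :\: U -> (x < i)%N /\ (N.-1 - i < f x)%N.
  rewrite !inE ltnS /= => /andP[nU xi]; rewrite xi /= in nU.
  have fx : f x <> x by move=> e; move/negP: nU; apply; apply/hitsP; exists x.
  have xi' : (x < i)%N.
    by rewrite ltn_neqAle xi andbT; apply/eqP => e; apply: fx; rewrite e.
  by split => //; rewrite -fr; apply: f2 => //; rewrite rk andbT; apply: ltn_trans ir.
have psiE x : x \in T :\: U -> psi x = (N.-1 - f x)%N :> nat.
  by move=> /Dprop[xi lt]; rewrite val_insubd ifT //; lia.
have psi_inj : {in T :\: U &, injective psi}.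
  move=> x x' xD xD' e; apply: (pbw_inj pf) => /=.
  have := psiE x xD; have := psiE x' xD'; rewrite e => ->.
  by have := fN x (ltn_ord x); have := fN x' (ltn_ord x'); lia.
have : (#|io |: [set psi x | x in T :\: U]| <= #|Z|)%N.
  apply: subset_leq_card; apply/subsetP => z; rewrite in_setU1 => /orP[/eqP ->|].
    by rewrite inE leqnn; apply/hitsP; exists (Ordinal rk).
  move=> /imsetP[x xD ->]; have [xi lt] := Dprop x xD; have fx := fN x (ltn_ord x).
  rewrite inE psiE //; apply/andP; split; first by lia.
  by apply/hitsP; exists x; lia.
rewrite cardsU1 (card_in_imset psi_inj) cD.
have -> /= : io \notin [set psi x | x in T :\: U].
  apply/imsetP => -[x xD /(congr1 val) /=]; rewrite psiE //; have [xi lt] := Dprop x xD.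
  by have fx := fN x (ltn_ord x); lia.
have key (u z a b uz t : nat) : (uz + a = u + z -> b = t - uz -> u <= t -> uz <= t ->
  1 + (t - u) <= z -> b < a)%N by lia.
exact: key cU cB cUT cUZT.
Qed.

Section StraightenColumn.
Variables (K : fieldType) (K0 : forall m, m.+1%:R != 0 :> K).
Variables (n N k : nat) (N2 : N = (2 * n)%N) (kn : (k <= n)%N).
Variables (Pt : Type) (I : finType) (V : Pt -> Prop) (X : I -> Pt -> K) (Q : I -> Prop).
Variables (M : Pt -> nat -> nat -> K) (VM : forall P, V P -> isotropic N k (M P)).

(** Sorting leaves the pair measure unchanged, each [isotropic_step] increases it, and it is bounded
    by [2 ^ k]. *)
Lemma straighten_column :
  (forall f, pbw k f -> admissible N k f -> (forall r, (r < k)%N -> (f r < N)%N) ->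
     inspan V X Q (fun P => minor k (M P) f)) ->
  forall f, (forall r, (r < k)%N -> (f r < N)%N) -> inspan V X Q (fun P => minor k (M P) f).
Proof.
move=> base f.
have [m] := ubnP (2 ^ k - pmeas N k f); elim: m f => // m IH f fm fN.
have [z|/pbw_sort[s ps]] := minor_injP K k f; first by apply: inspan0 => P _.
set g := permf s f in ps.
have gN r : (r < k)%N -> (g r < N)%N.
  by move=> rk; rewrite -[r]/(val (Ordinal rk)) /g permfE; apply: fN.
apply: (inspan_ext (p' := fun P => (-1) ^+ s * minor k (M P) g)).
  by move=> P _; rewrite minor_permf mulrA -expr2 sqrr_sign mul1r.
apply: inspanZ.
have hg x : hits k g x = hits k f x.
  apply/hitsP/hitsP => [[r <-]|[r <-]]; first by exists (s r); rewrite /g permfE.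
  by exists (s^-1%g r); rewrite /g permfE permKV.
have mg : pmeas N k g = pmeas N k f by apply: eq_bigl => x; rewrite /paired !hg.
have [ad|[i [r [irk gi gr]]]] := not_admissible ps gN; first exact: base.
apply: (isotropic_step K0 N2 kn (pbw_inj ps) gN (card_excess N2 kn ps gN irk gi gr) VM).
move=> g' g'N; rewrite mg => lt; apply: IH => //.
suff : (pmeas N k g' < 2 ^ k)%N by lia.
apply: leq_ltn_trans (sum_pow2 k); rewrite /pmeas big_mkcond; apply: leq_sum => x _.
by case: ifP.
Qed.

End StraightenColumn.

(** * The test curve in the big cell *)

Section Cell.
Variables (K : fieldType) (e : nat -> nat -> nat).

(* The point spanned in dimension k by the vectors w_c + sum_(t >= k) z^(e c t) w_t, c < k. *)
Definition cell_point (z : K) (k t c : nat) : K :=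
  if (t < k)%N then (t == c)%:R else z ^+ e c t.

Definition cell_poly k (f : nat -> nat) : {poly K} :=
  \det (\matrix_(r < k, c < k) if (f r < k)%N then (f r == c)%:R else 'X^(e c (f r))).

Lemma minor_cell_point z k f : minor k (cell_point z k) f = (cell_poly k f).[z].
Proof.
rewrite /cell_poly -horner_evalE -det_map_mx; congr (\det _).
apply/matrixP => r c; rewrite !mxE /cell_point /horner_eval.
by case: ifP => _; rewrite /= /horner_eval ?hornerXn ?hornerMn ?hornerC.
Qed.

(** The exponents do not depend on [k]: once row [k] is killed, the vectors of level [k] are the
    first [k] vectors of level [k.+1]. *)
Lemma cell_point_incidence n z : incidence n (cell_point z).
Proof.
move=> k _; exists (fun d c => (d == c)%:R) => t c ck.
have ck1 : (c < k.+1)%N by apply: ltnW.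
rewrite (bigD1 (Ordinal ck1)) //= eqxx mulr1 big1 ?addr0; last first.
  by move=> d; rewrite -val_eqE /= => /negPf ->; rewrite mulr0.
rewrite /cell_point (ltnS t k) (leq_eqVlt t k); case: (eqVneq t k) => [->|//=].
by rewrite gtn_eqF.
Qed.

(** The identity block leaves one term in each half of the form, [z ^+ e q (N.-1 - p)] and
    [z ^+ e p (N.-1 - q)], which agree by the symmetry of [e]. *)
Lemma cell_point_isotropic N k z : (k + k <= N)%N ->
  (forall p q, (p < k)%N -> (q < k)%N -> e q (N.-1 - p)%N = e p (N.-1 - q)%N) ->
  isotropic N k (cell_point z k).
Proof.
move=> kN sym p q pk qk; rewrite big_split /= sumrN /cell_point.
have H p' q' : (p' < k)%N -> \sum_(t < k) (if (t < k)%N then (t == p' :> nat)%:R else z ^+ e p' t) *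
   (if (N.-1 - t < k)%N then (N.-1 - t == q')%N%:R else z ^+ e q' (N.-1 - t)%N) = z ^+ e q' (N.-1 - p')%N.
  move=> pk'; rewrite (bigD1 (Ordinal pk')) //= pk' eqxx mul1r big1 ?addr0.
    by rewrite ifF //; lia.
  by move=> t; rewrite -val_eqE /= => /negPf ->; rewrite ltn_ord mul0r.
rewrite H // [X in _ - X](_ : _ = z ^+ e p (N.-1 - q)%N); first by rewrite sym // subrr.
by rewrite -(H q p qk); apply: eq_bigr => t _; rewrite mulrC.
Qed.

Definition cell_deg k (f : nat -> nat) : nat := (\sum_(r < k | k <= f r) e r (f r))%N.

Section Leading.
Variables (N k : nat).
Hypothesis e_super : forall p p' t t', (p < p' < k)%N -> (k <= t < t')%N -> (t' < N)%N ->
  (e p t + e p' t' < e p t' + e p' t)%N.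
Variables (f : nat -> nat) (pf : pbw k f) (fN : forall r, (r < k)%N -> (f r < N)%N).

Let phi (r q : 'I_k) : nat := if (k <= f r)%N then e q (f r) else 0%N.
Let valid (s : 'S_k) := [forall r : 'I_k, (f r < k)%N ==> (s r == r)].
Let wt (s : 'S_k) := (\sum_r phi r (s r))%N.

(** [valid] singles out the nonzero terms of the determinant. Let [r] be the first row moved by [s]
    and [q] its preimage. As [r < q] and both entries are at least [k], (ii) gives [f q < f r], and
    by supermodularity the transposition that makes [r] fixed increases the weight. *)
Lemma leading_improve (s : 'S_k) : valid s -> s != 1%g -> exists2 s', valid s' & (wt s < wt s')%N.
Proof.
move=> /forallP vs s1.
have ex : exists r : 'I_k, s r != r.
  apply/existsP; apply: contraT => /existsPn H; case/eqP: s1; apply/permP => r.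
  by rewrite perm1; apply/eqP; rewrite -[_ == _]negbK; apply: H.
case: ex => r0 r0P.
have [r sr rmin] := @arg_minnP _ r0 (fun r => s r != r) (fun r : 'I_k => r : nat) r0P.
have fix_lt (q : 'I_k) : (q < r)%N -> s q = q.
  move=> qr; apply/eqP; apply: contraTT qr => /rmin; by rewrite -leqNgt.
pose q := s^-1%g r; have sq : s q = r by rewrite permKV.
have qr : q != r by apply: contraNneq sr => {1}<-; rewrite sq.
have rq : (r < q)%N.
  rewrite ltn_neqAle eq_sym qr leqNgt; apply/negP => /fix_lt e'.
  by rewrite -e' sq eqxx in qr.
have rsr : (r < s r)%N.
  rewrite ltn_neqAle eq_sym sr leqNgt; apply/negP => /fix_lt /perm_inj e'.
  by rewrite e' eqxx in sr.
have mr : (k <= f r)%N.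
  by rewrite leqNgt; apply/negP => h; have := vs r; rewrite h (negPf sr).
have mq : (k <= f q)%N.
  rewrite leqNgt; apply/negP => h; have := vs q; rewrite h /= sq => /eqP e'.
  by rewrite -e' eqxx in qr.
have fqr : (f q < f r)%N.
  have [_ f2] := pf; apply: f2; first by rewrite rq ltn_ord.
  by have := ltn_ord r; lia.
exists (tperm r q * s)%g.
  apply/forallP => x; apply/implyP => fx; rewrite permM tpermD; first exact: (implyP (vs x)).
    by apply: contraTneq fx => <-; rewrite -leqNgt.
  by apply: contraTneq fx => <-; rewrite -leqNgt.
have rq' : r != q by rewrite eq_sym.
have := sum_tperm phi s rq'; rewrite /wt sq.
have : (phi r (s r) + phi q r < phi r r + phi q (s r))%N.
  rewrite /phi mr mq addnC; apply: e_super.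
  - by rewrite rsr ltn_ord.
  - by rewrite mq.
  - exact: fN.
have key (a b c d : nat) : (c < d -> a + c = b + d -> b < a)%N by lia.
exact: key.
Qed.

Lemma leading_unique (s : 'S_k) : valid s -> s != 1%g -> (wt s < wt 1%g)%N.
Proof.
move=> vs s1; have [s' vs' lt] := leading_improve vs s1.
have [m vm mmax] := @arg_maxnP _ s valid wt vs.
have [m1|/(leading_improve vm)[s2 vs2]] := eqVneq m 1%g.
  by rewrite -m1; apply: leq_trans lt _; apply: mmax.
by have := mmax s2 vs2; rewrite /= leqNgt => /negP.
Qed.

Lemma size_cell_poly : size (cell_poly k f) = (cell_deg k f).+1.
Proof.
pose Z : 'M[{poly K}]_k := \matrix_(r, c) if (f r < k)%N then (f r == c)%:R else 'X^(e c (f r)).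
rewrite /cell_poly -/Z.
have term (s : 'S_k) : \prod_r Z r (s r) =
   (if valid s then 'X^(wt s) else 0).
  case: (boolP (valid s)) => [/forallP vs|/forallPn[r]].
    rewrite -prodrXr; apply: eq_bigr => r _; rewrite mxE /phi (leqNgt k).
    case: ifP => //= h; have := vs r; rewrite h /= => /eqP ->.
    by have [f1 _] := pf; rewrite f1 // eqxx.
  rewrite negb_imply => /andP[fr sr]; rewrite (bigD1 r) //= mxE fr.
  have [f1 _] := pf; rewrite f1 // (_ : (r == s r :> nat) = false) ?mul0r //.
  by apply/negbTE; rewrite eq_sym.
have v1 : valid 1%g by apply/forallP => r; rewrite perm1 eqxx implybT.
have w1 : wt 1%g = cell_deg k f.
  by rewrite /wt /cell_deg [RHS]big_mkcond; apply: eq_bigr => r _; rewrite perm1.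
rewrite /determinant (bigD1 1%g) //= term v1 odd_perm1 expr0 mul1r w1 -(size_polyXn K).
rewrite size_polyDl //; apply: leq_ltn_trans (size_sum _ _ _) _.
rewrite size_polyXn ltnS; apply/bigmax_leqP => s s1; rewrite term.
case: ifP => vs; last by rewrite mulr0 size_poly0.
have := leading_unique vs s1; rewrite w1; apply: leq_trans.
rewrite -signr_odd; case: (odd _); rewrite ?expr0 ?expr1 ?mul1r ?mulN1r ?size_polyN size_polyXn //.
Qed.

End Leading.
End Cell.

(** * Degrees that separate standard tableaux *)

Lemma base_uniq (I : finType) (code : I -> nat) (D : nat) (a b : I -> nat) :
    injective code -> (forall i, (a i < D)%N) -> (forall i, (b i < D)%N) ->
    (\sum_i a i * D ^ code i = \sum_i b i * D ^ code i)%N ->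
  forall i, a i = b i.
Proof.
move=> inj aD bD e i0; apply/eqP; apply: contraT => ne0.
(* At the smallest position with different digits, the lower parts agree and the higher parts are
   divisible by [D * D ^ code i], so reduction modulo [D] isolates the digit. *)
have [i ne imin] := @arg_minnP _ i0 (fun i => a i != b i) code ne0.
have D0 : (0 < D)%N by apply: leq_ltn_trans (aD i).
have split_at c : (\sum_j c j * D ^ code j =
   \sum_(j | code j < code i) c j * D ^ code j + c i * D ^ code i +
   \sum_(j | code i < code j) c j * D ^ code j)%N.
  rewrite (bigID (fun j => code j < code i)%N) /= -addnA; congr (_ + _)%N.
  rewrite (bigD1 i) ?ltnn //=; congr (_ + _)%N; apply: eq_bigl => j.
  rewrite -leqNgt [RHS]ltn_neqAle andbC; congr (_ && _).
  by rewrite eq_sym (inj_eq inj).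
have high c : exists m, (\sum_(j | code i < code j) c j * D ^ code j = m * (D * D ^ code i))%N.
  exists (\sum_(j | code i < code j) c j * D ^ (code j - (code i).+1))%N.
  rewrite big_distrl; apply: eq_bigr => j lt /=.
  by rewrite -mulnA -expnS -expnD subnK.
move: e; rewrite !split_at.
have -> : (\sum_(j | code j < code i) a j * D ^ code j =
           \sum_(j | code j < code i) b j * D ^ code j)%N.
  apply: eq_bigr => j lt; congr (_ * _)%N; apply/eqP; apply: contraTT lt => /imin.
  by rewrite -leqNgt.
have [ma ->] := high a; have [mb ->] := high b.
rewrite -!addnA => /addnI; rewrite !mulnA -!mulnDl => /eqP.
rewrite eqn_pmul2r ?expn_gt0 ?D0 // => /eqP /(congr1 (modn^~ D)).
rewrite -!(addnC (_ * D)%N) !modnMDl !modn_small // => e.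
by rewrite e eqxx in ne.
Qed.

Section Degrees.
Variables (n N : nat) (N2 : N = (2 * n)%N) (N0 : (0 < N)%N) (L : nat) (kap : nat -> nat).
Hypothesis kapn : forall j, (j < L)%N -> (kap j <= n)%N.

Section MonPoly.
Variables (K : fieldType) (e : nat -> nat -> nat).
Hypothesis e_super : forall p p' t t', (p < p' < N)%N -> (t < t' < N)%N ->
  (e p t + e p' t' < e p t' + e p' t)%N.

Definition mon_poly (G : nat -> nat -> nat) : {poly K} :=
  \prod_(j < L) cell_poly K e (kap j) (G j).

Definition mon_deg (G : nat -> nat -> nat) : nat :=
  (\sum_(j < L) cell_deg e (kap j) (G j))%N.

Lemma mon_cell_point G z : mon L kap G (cell_point e z) = (mon_poly G).[z].
Proof.
by rewrite /mon_poly horner_prod; apply: eq_bigr => j _; rewrite minor_cell_point.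
Qed.

Lemma size_mon_poly G : (forall j, (j < L)%N -> pbw (kap j) (G j)) -> inrange N L kap G ->
  size (mon_poly G) = (mon_deg G).+1.
Proof.
move=> pG GN.
have sz (j : 'I_L) : size (cell_poly K e (kap j) (G j)) = (cell_deg e (kap j) (G j)).+1.
  apply: (@size_cell_poly _ _ N) => [p p' t t' pp tt t'N||]; last exact: GN; last exact: pG.
  apply: e_super; last by lia.
  by have := kapn (ltn_ord j); lia.
rewrite /mon_poly size_prod; last by move=> j _; rewrite -size_poly_eq0 sz.
rewrite (eq_bigr (fun j : 'I_L => 1 + cell_deg e (kap j) (G j))%N); last by move=> j _; rewrite sz.
by rewrite big_split /= sum1_card addnC -addSn addnK.
Qed.

End MonPoly.

(** [D] exceeds the number of columns, so counts of cells are digits in base [D]; [M] exceeds the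
    total fine part of at most [L * n] cells. *)
Let D := L.+2.
Let M := ((L * n).+1 * D ^ (N * N))%N.
Let q_ t := (N.-1 - t)%N.

(* In the coordinates [p], [q = bar t] the leading part [p * q] is symmetric; the digit
   [q < p] detects inadmissible cells, and the powers of [D] count how often each cell
   occurs. [wtS] is the symmetrization of [wtA] from the admissible cells. *)
Definition wtA p t := (M * (4 * (p * q_ t) + (q_ t < p)) + D ^ (p * N + q_ t))%N.
Definition wtS p t := (M * (4 * (p * q_ t)) + D ^ (minn p (q_ t) * N + maxn p (q_ t)))%N.

Let small_lt p q : (p < N)%N -> (q < N)%N -> (D ^ (p * N + q) < D ^ (N * N))%N.
Proof. by move=> pN qN; rewrite ltn_exp2l //; nia. Qed.

Let DM : (D ^ (N * N) <= M)%N.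
Proof. by rewrite /M mulSn leq_addr. Qed.

(** The products gain at least 4, the bits [o] lose at most 2, and the remaining [2 * M] outweighs
    two fine terms below [M]. *)
Lemma supermodular (o : nat -> nat -> bool) (s : nat -> nat -> nat) :
  (forall p q, (p < N)%N -> (q < N)%N -> (s p q < M)%N) ->
  forall p p' t t', (p < p' < N)%N -> (t < t' < N)%N ->
  (M * (4 * (p * q_ t) + o p t) + s p (q_ t) + (M * (4 * (p' * q_ t') + o p' t') + s p' (q_ t')) <
   M * (4 * (p * q_ t') + o p t') + s p (q_ t') + (M * (4 * (p' * q_ t) + o p' t) + s p' (q_ t)))%N.
Proof.
move=> sM p p' t t' pp tt.
have qq : (q_ t' < q_ t)%N by rewrite /q_; lia.
have qN : (q_ t < N)%N by rewrite /q_; lia.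
have H : (p * q_ t + p' * q_ t' + 1 <= p * q_ t' + p' * q_ t)%N by clear -pp qq; nia.
have s1 := sM p (q_ t) (ltac:(lia)) qN.
have s2 := sM p' (q_ t') (ltac:(lia)) (ltac:(lia)).
move: (o p t) (o p' t') (o p t') (o p' t) => o1 o2 o3 o4.
have H2 : (4 * (p * q_ t) + o1 + (4 * (p' * q_ t') + o2) + 2 <= 4 * (p * q_ t') + o3 + (4 * (p' * q_ t) + o4))%N.
  by case: o1; case: o2; clear -H; lia.
move: H2 s1 s2; clear.
move: (_ + o1)%N (_ + o2)%N (_ + o3)%N (_ + o4)%N (s _ _) (s _ _) (s _ _) (s _ _) => x1 x2 x3 x4 y1 y2 y3 y4 h h1 h2.
have : (M * (x1 + x2 + 2) <= M * (x3 + x4))%N by rewrite leq_mul2l h orbT.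
move: h1 h2; move: M => m; clear; nia.
Qed.

Lemma wtA_super p p' t t' : (p < p' < N)%N -> (t < t' < N)%N ->
  (wtA p t + wtA p' t' < wtA p t' + wtA p' t)%N.
Proof.
apply: (@supermodular (fun p t => q_ t < p)%N (fun p q => D ^ (p * N + q))%N) => p0 q0 h1 h2.
exact: leq_trans (small_lt h1 h2) DM.
Qed.

Lemma wtS_super p p' t t' : (p < p' < N)%N -> (t < t' < N)%N ->
  (wtS p t + wtS p' t' < wtS p t' + wtS p' t)%N.
Proof.
move=> pp tt; rewrite /wtS.
have := @supermodular (fun _ _ => false) (fun p q => D ^ (minn p q * N + maxn p q))%N _ p p' t t' pp tt.
rewrite !addn0; apply => p0 q0 h1 h2.
by apply: leq_trans (small_lt _ _) DM; lia.
Qed.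

Lemma wtS_sym p q : (p < N)%N -> (q < N)%N -> wtS q (N.-1 - p)%N = wtS p (N.-1 - q)%N.
Proof.
move=> pN qN; rewrite /wtS /q_.
rewrite (_ : N.-1 - (N.-1 - p) = p)%N; last by lia.
rewrite (_ : N.-1 - (N.-1 - q) = q)%N; last by lia.
by rewrite mulnC [(q * p)%N]mulnC minnC maxnC [(_ * M)%N]mulnC.
Qed.

Lemma wtAS p t : (p + t < N)%N -> wtA p t = wtS p t.
Proof.
move=> pt; rewrite /wtA /wtS; have le : (p <= q_ t)%N by rewrite /q_; lia.
by rewrite ltnNge le /= addn0 (minn_idPl le) (maxn_idPr le).
Qed.

Definition mainS (G : nat -> nat -> nat) :=
  (\sum_(j < L) \sum_(r < kap j | kap j <= G j r) 4 * (r * q_ (G j r)))%N.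
Definition mainA (G : nat -> nat -> nat) :=
  (\sum_(j < L) \sum_(r < kap j | kap j <= G j r) (4 * (r * q_ (G j r)) + (q_ (G j r) < r)))%N.
Definition fineA (G : nat -> nat -> nat) :=
  (\sum_(j < L) \sum_(r < kap j | kap j <= G j r) D ^ (r * N + q_ (G j r)))%N.
Definition fineS (G : nat -> nat -> nat) :=
  (\sum_(j < L) \sum_(r < kap j | kap j <= G j r) D ^ (minn r (q_ (G j r)) * N + maxn r (q_ (G j r))))%N.

Lemma mon_degA G : mon_deg wtA G = (M * mainA G + fineA G)%N.
Proof.
rewrite /mainA big_distrr -big_split; apply: eq_bigr => j _ /=.
by rewrite big_distrr -big_split; apply: eq_bigr.
Qed.

Lemma mon_degS G : mon_deg wtS G = (M * mainS G + fineS G)%N.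
Proof.
rewrite /mainS big_distrr -big_split; apply: eq_bigr => j _ /=.
by rewrite big_distrr -big_split; apply: eq_bigr.
Qed.

Let sum_small (G : nat -> nat -> nat) (F : nat -> nat -> nat) :
  (forall j r, (j < L)%N -> (r < kap j)%N -> (F j r <= D ^ (N * N))%N) ->
  (\sum_(j < L) \sum_(r < kap j | kap j <= G j r) F j r < M)%N.
Proof.
move=> H; apply: (@leq_ltn_trans (\sum_(j < L) n * D ^ (N * N))%N); last first.
  by rewrite sum_nat_const card_ord mulnA /M ltn_mul2r expn_gt0 ltnSn.
apply: leq_sum => j _; apply: (@leq_trans (\sum_(r < kap j) D ^ (N * N))%N).
  rewrite big_mkcond; apply: leq_sum => r _; case: ifP => // _; exact: H.
by rewrite sum_nat_const card_ord leq_mul2r kapn ?orbT.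
Qed.

Lemma fineA_lt G : (fineA G < M)%N.
Proof.
apply: (@sum_small G (fun j r => D ^ (r * N + q_ (G j r)))%N) => j r jL rk.
by apply/ltnW/small_lt; have := kapn jL; rewrite /q_; lia.
Qed.

Lemma fineS_lt G : (fineS G < M)%N.
Proof.
apply: (@sum_small G (fun j r => D ^ (minn r (q_ (G j r)) * N + maxn r (q_ (G j r))))%N) => j r jL rk.
by apply/ltnW/small_lt; have := kapn jL; rewrite /q_; lia.
Qed.

Let M0 : (0 < M)%N.
Proof. exact: leq_ltn_trans (leq0n _) (fineA_lt (fun _ _ => 0%N)). Qed.

Lemma leq_mainA G G' : (mon_deg wtA G <= mon_deg wtA G')%N -> (mainA G <= mainA G')%N.
Proof.
rewrite !mon_degA => /(leq_div2r M); rewrite !(mulnC M) !divnMDl //.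
by rewrite !divn_small ?fineA_lt // !addn0.
Qed.

Lemma leq_mainS G G' : (mon_deg wtS G <= mon_deg wtS G')%N -> (mainS G <= mainS G')%N.
Proof.
rewrite !mon_degS => /(leq_div2r M); rewrite !(mulnC M) !divnMDl //.
by rewrite !divn_small ?fineS_lt // !addn0.
Qed.

Definition admissible_all (G : nat -> nat -> nat) := forall j, (j < L)%N -> admissible N (kap j) (G j).

Lemma admissible_mainA G : admissible_all G -> mainA G = mainS G.
Proof.
move=> aG; apply: eq_bigr => j _; apply: eq_bigr => r _.
have := aG j (ltn_ord j) r (ltn_ord r) => h.
by rewrite ltnNge (_ : (r <= q_ (G j r))%N) ?addn0 //; rewrite /q_; lia.
Qed.

Lemma admissible_deg G : admissible_all G -> mon_deg wtS G = mon_deg wtA G.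
Proof.
move=> aG; apply: eq_bigr => j _; apply: eq_bigr => r _.
by rewrite wtAS // addnC; apply: aG.
Qed.

(** An inadmissible cell has [q_ (G j r) < r], and its detecting bit enters [mainA] only. This gap
    is the decrease in the final induction. *)
Lemma mainA_dichotomy G : (forall j, (j < L)%N -> pbw (kap j) (G j)) -> inrange N L kap G ->
  admissible_all G \/ (mainS G < mainA G)%N.
Proof.
move=> pG GN.
case: (boolP [forall j : 'I_L, forall r : 'I_(kap j), (G j r + r < N)%N]).
  by move=> /forallP H; left=> j jL r rk; have /forallP/(_ (Ordinal rk)) := H (Ordinal jL).
move=> /forallPn[j /forallPn[r h]]; right.
have jL := ltn_ord j; have kn := kapn jL; have rk := ltn_ord r.
have GjN := GN j jL r rk.
have mv : (kap j <= G j r)%N.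
  rewrite leqNgt; apply/negP => lt; have [f1 _] := pG j jL.
  by move: h; rewrite f1 //; lia.
rewrite /mainS /mainA (bigD1 j) //= [X in (_ < X)%N](bigD1 j) //= -addSn; apply: leq_add.
  rewrite (bigD1 r) //= [X in (_ < X)%N](bigD1 r) //= -addSn; apply: leq_add.
    by rewrite (_ : (q_ (G j r) < r)%N) ?addn1 //; rewrite /q_; lia.
  by apply: leq_sum => r' _; rewrite leq_addr.
by apply: leq_sum => j' _; apply: leq_sum => r' _; rewrite leq_addr.
Qed.

Definition occurs (G : nat -> nat -> nat) r q j :=
  [&& (r < kap j)%N, (kap j <= G j r)%N & q_ (G j r) == q].

Definition occ G r q := (\sum_(j < L) occurs G r q j)%N.

Lemma fineA_occ G : fineA G = (\sum_(c : 'I_n * 'I_N) occ G c.1 c.2 * D ^ (c.1 * N + c.2))%N.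
Proof.
rewrite (eq_bigr (fun c : 'I_n * 'I_N => \sum_(j < L) occurs G c.1 c.2 j * D ^ (c.1 * N + c.2))%N); last first.
  by move=> c _; rewrite /occ big_distrl.
rewrite exchange_big; apply: eq_bigr => j _ /=.
rewrite -(pair_big xpredT xpredT (fun (r : 'I_n) (q : 'I_N) => occurs G r q j * D ^ (r * N + q)))%N /=.
rewrite (big_ord_widen_cond n (fun r => kap j <= G j r)%N (fun r => D ^ (r * N + q_ (G j r)))%N) ?kapn //.
rewrite big_mkcond; apply: eq_bigr => r _.
have qN : (q_ (G j r) < N)%N by rewrite /q_; lia.
rewrite (bigD1 (Ordinal qN)) //= big1 ?addn0; last first.
  move=> q; rewrite -val_eqE /= eq_sym => /negPf nq.
  by rewrite /occurs nq !andbF.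
by rewrite /occurs eqxx andbT andbC; case: ifP; rewrite ?mul1n.
Qed.

Lemma occ_eq G G' : fineA G = fineA G' -> forall r q, (r < n)%N -> (q < N)%N -> occ G r q = occ G' r q.
Proof.
rewrite !fineA_occ => /base_uniq e r q rn qN.
apply: (e _ _ _ (Ordinal rn, Ordinal qN)).
- move=> [x y] [x' y'] /= h.
  have hy : y = y' :> nat.
    by have := congr1 (modn^~ N) h; rewrite !modnMDl !modn_small.
  have hx : x = x' :> nat.
    have := congr1 (divn^~ N) h; rewrite !divnMDl // !divn_small //; lia.
  by congr pair; apply: val_inj.
- move=> i; rewrite /occ; apply: (@leq_ltn_trans (\sum_(j < L) 1)%N); last by rewrite sum1_card card_ord /D.
  by apply: leq_sum => j _; case: occurs.
- move=> i; rewrite /occ; apply: (@leq_ltn_trans (\sum_(j < L) 1)%N); last by rewrite sum1_card card_ord /D.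
  by apply: leq_sum => j _; case: occurs.
Qed.

Lemma stdA_trans G j j' r : stdA L kap G -> (j <= j')%N -> (j' < L)%N -> (r < kap j')%N ->
  exists2 i, (r <= i < kap j)%N & (G j' r <= G j i)%N.
Proof.
move=> [_ G2]; elim: j' r => [|j' IH] r jj jL rk.
  by have -> : j = 0%N by [lia]; exists r; rewrite ?leqnn.
move: jj; rewrite leq_eqVlt => /orP[/eqP ->|jj]; first by exists r; rewrite ?leqnn.
have [q /andP[rq qk] le] := G2 j' jL r rk.
have [i /andP[qi ik] le'] := IH q jj (ltnW jL) qk.
by exists i; [rewrite (leq_trans rq qi) | apply: leq_trans le le'].
Qed.

(** In [G] the value [G' j r] cannot occur in row [r] from column [j] on: by (iv) column [j] would
    have an entry at least as large from row [r] on, but its entry in row [r] is smaller, and its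
    later entries agree with [G'], where (ii) makes them smaller. Columns before [j] agree, so the
    counts differ. *)
Lemma occ_lt G G' j r : stdA L kap G -> stdA L kap G' -> inrange N L kap G -> inrange N L kap G' ->
    (j < L)%N -> (r < kap j)%N ->
    (forall j', (j' < L)%N -> forall i, (r < i < kap j')%N -> G j' i = G' j' i) ->
    (forall j', (j' < j)%N -> (r < kap j')%N -> G j' r = G' j' r) ->
  (G j r < G' j r)%N -> occ G r (q_ (G' j r)) <> occ G' r (q_ (G' j r)).
Proof.
move=> sG sG' GN G'N jL rk below left lt; have [pG _] := sG; have [pG' _] := sG'.
have mv : (kap j <= G' j r)%N.
  rewrite leqNgt; apply/negP => h; have [f1 _] := pG' j jL; have e := f1 r rk h.
  have [g1 _] := pG j jL; have := g1 r rk; lia.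
apply/eqP; rewrite neq_ltn; apply/orP; left.
rewrite /occ (bigD1 (Ordinal jL)) //= [X in (_ < X)%N](bigD1 (Ordinal jL)) //= -addSn.
have none j' : (j <= j')%N -> (j' < L)%N -> occurs G r (q_ (G' j r)) j' = false.
  move=> jj j'L; apply/negP => /and3P[rk' mv' /eqP eq].
  have e : G j' r = G' j r.
    by have := GN _ j'L _ rk'; have := G'N _ jL _ rk; move: eq; rewrite /q_; lia.
  have [i /andP[ri ik] le] := stdA_trans sG jj j'L rk'.
  move: ri; rewrite leq_eqVlt => /orP[/eqP er|ri]; first by rewrite -er in le; lia.
  have : (G' j i < G' j r)%N.
    by have [_ f2] := pG' j jL; apply: f2; [rewrite ri|lia].
  by rewrite -below ?ri //; lia.
apply: leq_add; first by rewrite none // /occurs rk mv eqxx.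
apply: leq_sum => j' _; case: (ltnP j' j) => [j'j|jj]; last by rewrite none.
rewrite /occurs; case: (boolP (r < kap j')%N) => //= rk'.
by rewrite left.
Qed.

Hypothesis kap_dec : forall j, (j.+1 < L)%N -> (kap j.+1 <= kap j)%N.

(** Rebuilds the filling from its occurrence numbers, rows from the last to the first and columns
    from left to right; [occ_lt] rules out a first difference. *)
Lemma fineA_inj G G' : stdA L kap G -> stdA L kap G' -> inrange N L kap G -> inrange N L kap G' ->
  fineA G = fineA G' -> agree L kap G G'.
Proof.
move=> sG sG' GN G'N e.
suff H m : forall r, (n - r <= m)%N -> forall j, (j < L)%N -> (r < kap j)%N -> G j r = G' j r.
  by move=> j jL r rk; apply: (H n) => //; apply: leq_subr.
elim: m => [|m IHm] r rm; first by move=> j jL rk; have := kapn jL; lia.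
elim/ltn_ind => j IHj jL rk; have kn := kapn jL.
have below j' : (j' < L)%N -> forall i, (r < i < kap j')%N -> G j' i = G' j' i.
  by move=> j'L i /andP[ri ik]; apply: IHm => //; lia.
have left j' : (j' < j)%N -> (r < kap j')%N -> G j' r = G' j' r.
  by move=> j'j rk'; apply: IHj => //; apply: ltn_trans jL.
have rn : (r < n)%N by lia.
have qN t : (q_ t < N)%N by rewrite /q_; lia.
have oe q : (q < N)%N -> occ G r q = occ G' r q by exact: (occ_eq e).
case: (ltngtP (G j r) (G' j r)) => // lt; exfalso.
  by apply: (occ_lt sG sG' GN G'N jL rk below left lt); apply: oe.
apply: (occ_lt sG' sG G'N GN jL rk _ _ lt).
- by move=> j' j'L i ri; rewrite below.
- by move=> j' j'j rk'; rewrite left.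
- by symmetry; apply: oe.
Qed.

Lemma mon_degA_inj (T T' : table n N L) : tstdA kap T -> tstdA kap T' ->
  mon_deg wtA (cell T) = mon_deg wtA (cell T') -> T = T'.
Proof.
move=> [cT sT] [cT' sT']; rewrite !mon_degA => /(congr1 (modn^~ M)).
rewrite !(mulnC M) !modnMDl !modn_small ?fineA_lt // => e.
by apply: (agree_canon cT cT'); apply: fineA_inj => // j jL r rk; apply: cell_ltN.
Qed.

End Degrees.

(** * Alternating the two straightenings *)

Lemma inspan_trans (K : fieldType) (Pt : Type) (I J : finType) (V V' : Pt -> Prop)
    (X : I -> Pt -> K) (Y : J -> Pt -> K) (Q : I -> Prop) (Q' : J -> Prop) p :
  (forall P, V' P -> V P) -> inspan V X Q p ->
  (forall i, Q i -> inspan V' Y Q' (X i)) -> inspan V' Y Q' p.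
Proof.
move=> V'V [c cQ cE] H.
apply: (inspan_ext (p' := fun P => \sum_i c i * X i P)) => [P /V'V /cE //|].
apply: inspan_sum => i _; have [c0|/cQ/H] := eqVneq (c i) 0; last exact: inspanZ.
by apply: inspan0 => P _; rewrite c0 mul0r.
Qed.

Section Symplectic.
Variables (K : fieldType) (K0 : forall m, m.+1%:R != 0 :> K).
Variables (n N : nat) (N2 : N = (2 * n)%N) (N0 : (0 < N)%N).

Definition symplectic (P : nat -> nat -> nat -> K) :=
  incidence n P /\ forall k, (k <= n)%N -> isotropic N k (P k).

Definition tstdS L kap (T : table n N L) := tstdA kap T /\ admissible_all N L kap (cell T).

Lemma cell_point_symplectic L z : symplectic (cell_point (wtS n N L) z).
Proof.
split=> [|k kn]; first exact: cell_point_incidence.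
apply: cell_point_isotropic => [|p q pk qk]; first by lia.
by apply: wtS_sym; lia.
Qed.

Lemma tstdS_inj L kap (T T' : table n N L) :
  (forall j, (j < L)%N -> (kap j <= n)%N) -> (forall j, (j.+1 < L)%N -> (kap j.+1 <= kap j)%N) ->
  tstdS kap T -> tstdS kap T' ->
  mon_deg L kap (wtS n N L) (cell T) = mon_deg L kap (wtS n N L) (cell T') -> T = T'.
Proof.
move=> kapn kap_dec [sT aT] [sT' aT']; rewrite !admissible_deg //.
exact: mon_degA_inj.
Qed.

Lemma size_wtS L kap (T : table n N L) :
  (forall j, (j < L)%N -> (kap j <= n)%N) -> tstdA kap T ->
  size (mon_poly L kap K (wtS n N L) (cell T)) = (mon_deg L kap (wtS n N L) (cell T)).+1.
Proof.
move=> kapn [_ [pT _]]; apply: (@size_mon_poly n N) => //.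
  by move=> *; apply: wtS_super.
by move=> j jL r rk; apply: cell_ltN.
Qed.

Definition col_main k (f : nat -> nat) := (\sum_(r < k | k <= f r) 4 * (r * (N.-1 - f r)))%N.

(** Viewing the column as a table with one column lets [inspan_restrict], applied to the symplectic
    curve of [wtS], bound the main part of every column in the expansion. *)
Lemma column_span k f : (k <= n)%N -> pbw k f -> (forall r, (r < k)%N -> (f r < N)%N) ->
  inspan symplectic (fun (T : table n N 1) P => minor k (P k) (cell T 0))
    (fun T => [/\ pbw k (cell T 0), admissible N k (cell T 0) & (col_main k (cell T 0) <= col_main k f)%N])
    (fun P => minor k (P k) f).
Proof.
move=> kn pf fN; pose kap := fun _ : nat => k.
have kapn j : (j < 1)%N -> (kap j <= n)%N by [].
have kapd j : (j.+1 < 1)%N -> (kap j.+1 <= kap j)%N by [].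
have mon1 G P : mon 1 kap G P = minor k (P k) (G 0%N) :> K by rewrite /mon big_ord1.
have fNN : inrange N 1 kap (fun _ => f) by move=> j _.
have span : inspan symplectic (fun T : table n N 1 => mon 1 kap (cell T)) (tstdS kap) (fun P => minor k (P k) f).
  apply: (straighten_column K0 N2 kn (M := fun P => P k)) fN => [P [_ iso]|g pg ag gN]; first exact: iso.
  have gNN : inrange N 1 kap (fun _ => g) by move=> j _.
  have e := cell_tabulate N0 kapn gNN.
  apply: (inspan_ext (p' := mon 1 kap (cell (tabulate n N0 1 kap (fun _ => g))))) => [P _|].
    by rewrite -(eq_mon P e) mon1.
  apply: (@inspan_gen _ _ _ _ (fun T => mon 1 kap (cell T))); split.
    split; first exact: canon_tabulate.
    by apply: (eq_stdA e); split=> [j|j].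
  by move=> j j1 r rk; rewrite -e // ; apply: ag.
have := inspan_restrict K0 (gam := cell_point (wtS n N 1))
  (pX := fun T => mon_poly 1 kap K (wtS n N 1) (cell T))
  (pp := mon_poly 1 kap K (wtS n N 1) (fun _ => f)) _ _ _ _ _ span.
case.
- exact: cell_point_symplectic.
- by move=> T z _; apply: mon_cell_point.
- by move=> z; rewrite -mon_cell_point mon1.
- by move=> T [sT _]; rewrite -size_poly_eq0 size_wtS.
- move=> T T' sT sT'; have [[aT _] [aT' _]] := (sT, sT').
  by rewrite !size_wtS // => -[]; apply: tstdS_inj.
move=> c cQ cE; exists c => [T /cQ[[sA aT] le]|P VP]; last first.
  by rewrite cE //; apply: eq_bigr => T _; rewrite mon1.
have [_ [pT _]] := sA; split; [exact: (pT 0%N) | exact: (aT 0%N) |].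
have main1 G : mainS N 1 kap G = col_main k (G 0%N) by rewrite /mainS big_ord1.
rewrite -[X in (_ <= X)%N](main1 (fun _ => f)) -(main1 (cell T)).
apply: (leq_mainS N2 N0 kapn); move: le; rewrite (size_wtS kapn sA).
by rewrite (@size_mon_poly n N) // => *; apply: wtS_super.
Qed.

Section Shape.
Variables (L : nat) (kap : nat -> nat).
Hypothesis kapn : forall j, (j < L)%N -> (kap j <= n)%N.
Hypothesis kap_dec : forall j, (j.+1 < L)%N -> (kap j.+1 <= kap j)%N.
Variables (I : finType) (X : I -> (nat -> nat -> nat -> K) -> K) (Q : I -> Prop).

(** Columns are made admissible one at a time, from the last to the first. The main part is a sum
    over columns, so by [column_span] it never grows. *)
Lemma straighten_columns w :
  (forall G, (forall j, (j < L)%N -> pbw (kap j) (G j)) -> inrange N L kap G ->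
    admissible_all N L kap G -> (mainS N L kap G <= w)%N -> inspan symplectic X Q (mon L kap G)) ->
  forall G, (forall j, (j < L)%N -> pbw (kap j) (G j)) -> inrange N L kap G ->
    (mainS N L kap G <= w)%N -> inspan symplectic X Q (mon L kap G).
Proof.
move=> base.
suff H s G : (forall j, (j < L)%N -> pbw (kap j) (G j)) -> inrange N L kap G ->
    (mainS N L kap G <= w)%N ->
    (forall j, (s <= j < L)%N -> admissible N (kap j) (G j)) -> inspan symplectic X Q (mon L kap G).
  by move=> G pG GN Gw; apply: (H L) => // j; lia.
elim: s G => [|s IH] G pG GN Gw aG; first exact: base.
case: (ltnP s L) => sL; last by apply: IH => // j; lia.
pose so := Ordinal sL; set k := kap s.
have kn : (k <= n)%N := kapn sL.
have [c cQ cE] := column_span kn (pG _ sL) (GN _ sL).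
pose upd g j := if j == s then g else G j.
pose R P : K := \prod_(j < L | j != so) minor (kap j) (P (kap j)) (G j).
have updE g P : mon L kap (upd g) P = R P * minor k (P k) g.
  rewrite /mon (bigD1 so) //= /upd eqxx mulrC; congr (_ * _).
  by apply: eq_bigr => j; rewrite -val_eqE /= => /negPf ->.
have updG P : mon L kap G P = R P * minor k (P k) (G s).
  by rewrite /mon (bigD1 so) //= mulrC.
apply: (inspan_ext (p' := fun P => \sum_T c T * mon L kap (upd (cell T 0)) P)).
  move=> P VP; rewrite updG cE // mulr_sumr; apply: eq_bigr => T _.
  by rewrite updE mulrCA.
apply: inspan_sum => T _.
have [c0|/cQ[pT aT mT]] := eqVneq (c T) 0.
  by apply: inspan0 => P _; rewrite c0 mul0r.
apply: inspanZ; apply: IH.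
- by move=> j jL; rewrite /upd; case: eqP => [->|_]; [|exact: pG].
- by move=> j jL r rk; rewrite /upd; case: eqP => _; [exact: cell_ltN|exact: GN].
- apply: leq_trans Gw; rewrite /mainS (bigD1 so) //= [X in (_ <= X)%N](bigD1 so) //=.
  apply: leq_add; first by rewrite /upd eqxx.
  by apply: leq_sum => j; rewrite -val_eqE /upd /= => /negPf ->.
- move=> j /andP[sj jL]; rewrite /upd; case: eqP => [->//|js].
  by apply: aG; lia.
Qed.

End Shape.

(** Induction on [mainS]. Once the columns of [G] are admissible, [mainA] and [mainS] agree on [G],
    and each tableau [T] in its expansion for (iv) has [mainA] at most that of [G]. Such a [T] is
    admissible, or its [mainS] is strictly smaller than its [mainA] and the induction applies. *)
Theorem symplectic_straighten L kap G :
  (forall j, (j < L)%N -> (kap j <= n)%N) -> (forall j, (j.+1 < L)%N -> (kap j.+1 <= kap j)%N) ->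
  inrange N L kap G ->
  inspan symplectic (fun T : table n N L => mon L kap (cell T)) (tstdS kap) (mon L kap G).
Proof.
move=> kapn kap_dec GN0.
have [z|[G' [e [eE pG' G'N]]]] := mon_sort K GN0; first exact: inspan0.
apply: (inspan_ext (p' := fun P => e * mon L kap G' P)) => [P _//|].
apply: inspanZ; move: G' pG' G'N {eE GN0 G e} => G.
have [w] := ubnP (mainS N L kap G); elim: w G => // w IH G Gw pG GN.
apply: (@straighten_columns L kap kapn _ _ _ w) => // {}G {}pG {}GN aG {}Gw.
have := straighten N0 kapn K0 kap_dec GN.
have incid (z : K) : incidence n (cell_point (wtA n N L) z) by exact: cell_point_incidence.
have sz G0 : (forall j, (j < L)%N -> pbw (kap j) (G0 j)) -> inrange N L kap G0 ->
   size (mon_poly L kap K (wtA n N L) G0) = (mon_deg L kap (wtA n N L) G0).+1.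
  by move=> p0 N0'; apply: (@size_mon_poly n N) => // *; apply: wtA_super.
have cN (T : table n N L) : inrange N L kap (cell T) by move=> j jL r rk; apply: cell_ltN.
move/(inspan_restrict K0 (gam := cell_point (wtA n N L))
  (pX := fun T => mon_poly L kap K (wtA n N L) (cell T))
  (pp := mon_poly L kap K (wtA n N L) G) incid) => H.
(* The curve of [wtA] satisfies the incidence relations but need not be isotropic, so the degree
   bound is obtained over incidence points and then restricted to symplectic ones. *)
apply: (inspan_trans (fun P (VP : symplectic P) => proj1 VP) (H _ _ _ _)).
- by move=> T z _; apply: mon_cell_point.
- by move=> z; apply: mon_cell_point.
- by move=> T [_ [pT _]]; rewrite -size_poly_eq0 sz.
- move=> T T' sT sT'; have [[_ [pT _]] [_ [pT' _]]] := (sT, sT').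
  by rewrite !sz // => -[]; apply: mon_degA_inj.
move=> T [sT]; have [_ [pT _]] := sT; rewrite !sz // ltnS => /(leq_mainA N2 N0 kapn) le.
have [aT|lt] := mainA_dichotomy N2 N0 kapn pT (cN T).
  exact: (@inspan_gen _ _ _ _ (fun T => mon L kap (cell T))).
apply: IH => //; apply: leq_trans lt _; apply: leq_trans le _.
by rewrite (admissible_mainA N2 N0 kapn aG).
Qed.

End Symplectic.

(** * Translation to the variety and the tableaux of the theorem *)

Lemma C_natr_neq0 m : m.+1%:R != 0 :> C.
Proof. by have : m.+1%:R != 0 :> (Rdefinitions.R)[i] by rewrite pnatr_eq0. Qed.

Definition entries n (A : forall k : nat, 'M[C]_(2 * n, k)) (k t c : nat) : C :=
  if insub c is Some c' then ent (A k) t.+1 c' else 0.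

Lemma entriesE n (A : forall k : nat, 'M[C]_(2 * n, k)) k (t : 'I_(2 * n)) (c : 'I_k) :
  entries A k t c = A k t c.
Proof. by rewrite /entries valK /ent valK. Qed.

Lemma entries_out n (A : forall k : nat, 'M[C]_(2 * n, k)) k t c : (2 * n <= t)%N ->
  entries A k t c = 0.
Proof.
move=> tn; rewrite /entries; case: insub => // c'.
by rewrite /ent insubF //= ltnNge tn.
Qed.

Lemma symp_pr13 n k (M : 'M[C]_(2 * n, k)) (m : nat -> nat -> C) (x y : 'cV[C]_k) : (k <= n)%N ->
  (forall (t : 'I_(2 * n)) (c : 'I_k), M t c = m t c) ->
  symp (pr13 k (M *m x)) (pr13 k (M *m y)) = \sum_(p < k) \sum_(q < k) x p 0 * y q 0 *
    \sum_(t < k) (m t p * m ((2 * n).-1 - t)%N q - m ((2 * n).-1 - t)%N p * m t q).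
Proof.
move=> kn Mm.
pose term (p q : 'I_k) (t : nat) := m t p * m ((2 * n).-1 - t)%N q - m ((2 * n).-1 - t)%N p * m t q.
transitivity (\sum_(t < 2 * n | (t < k)%N) \sum_(p < k) \sum_(q < k) x p 0 * y q 0 * term p q t).
  rewrite /symp [LHS]big_mkcond [RHS]big_mkcond; apply: eq_bigr => t _.
  have tn := ltn_ord t.
  case: (ltnP t k) => tk; last first.
    case: ifP => // tn'; rewrite !mxE.
    by rewrite (_ : (t < k)%N || (2 * n - k <= t)%N = false) ?mul0r ?mulr0 ?subr0 //; lia.
  rewrite ifT; last by lia.
  rewrite !mxE tk /= (_ : (_ || _) = true); last by lia.
  rewrite !mulr_suml -sumrB; apply: eq_bigr => p _.
  rewrite !mulr_sumr -sumrB; apply: eq_bigr => q _.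
  rewrite !Mm /term (_ : (2 * n).-1 - t = 2 * n - t.+1)%N; last by lia.
  by rewrite /= mulrBr; congr (_ - _); rewrite mulrACA mulrC.
have k2 : (k <= 2 * n)%N by lia.
rewrite -(big_ord_widen _ (fun t => \sum_(p < k) \sum_(q < k) x p 0 * y q 0 * term p q t) k2).
rewrite exchange_big; apply: eq_bigr => p _ /=.
rewrite exchange_big; apply: eq_bigr => q _ /=.
by rewrite -mulr_sumr.
Qed.

Lemma entries_symplectic n (A : forall k : nat, 'M[C]_(2 * n, k)) :
  in_variety A -> symplectic n (2 * n) (entries A).
Proof.
move=> [_ iso inc]; split=> [k k0n|k kn p q pk qk].
  have H (c : 'I_k) : exists y : 'cV[C]_k.+1,
      prk k.+1 (A k *m \col_d (d == c)%:R) = A k.+1 *m y by apply: inc.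
  have [y yE] := fin_all_exists H.
  exists (fun d c => if insub c is Some c' then if insub d is Some d' then y c' d' 0 else 0 else 0).
  move=> t c ck; rewrite -[c]/(val (Ordinal ck)); move: (Ordinal ck) => {c ck} c /=.
  case: (ltnP t (2 * n)) => tn; last first.
    rewrite entries_out // if_same big1 // => d _.
    by rewrite entries_out // mul0r.
  have := congr1 (fun M : 'cV[C]_(2 * n) => M (Ordinal tn) 0) (yE c).
  rewrite !mxE eqSS /= => e; rewrite -[t]/(val (Ordinal tn)) entriesE /=.
  transitivity (if t == k then 0 else \sum_j A k (Ordinal tn) j * (\col_d (d == c)%:R) j 0).
    case: ifP => // _; rewrite (bigD1 c) //= !mxE eqxx mulr1 big1 ?addr0 // => j jc.
    by rewrite mxE (negPf jc) mulr0.
  rewrite e; apply: eq_bigr => d _; rewrite -[t]/(val (Ordinal tn)) entriesE.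
  by rewrite !valK.
have k1 : (1 <= k <= n)%N by lia.
have := iso k k1 (\col_d (d == Ordinal pk)%:R) (\col_d (d == Ordinal qk)%:R).
rewrite (symp_pr13 (m := entries A k)) //; last by move=> t c; rewrite entriesE.
rewrite (bigD1 (Ordinal pk)) //= [X in _ + X]big1 ?addr0; last first.
  by move=> i ip; rewrite big1 // => j _; rewrite mxE (negPf ip) !mul0r.
rewrite (bigD1 (Ordinal qk)) //= [X in _ + X]big1 ?addr0; last first.
  by move=> j jq; rewrite !mxE (negPf jq) mulr0 mul0r.
by rewrite !mxE !eqxx !mul1r.
Qed.

(** The identity block gives the rank, and the relations for the columns extend to all vectors by
    linearity. *)
Lemma cell_variety n (e : nat -> nat -> nat) (z : C) :
  symplectic n (2 * n) (cell_point e z) ->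
  in_variety (fun k => \matrix_(t < 2 * n, c < k) cell_point e z k t c).
Proof.
move=> [inc iso]; split=> [k /andP[k0 kn]|k /andP[k0 kn] x y|k kn x].
- apply/eqP; rewrite eqn_leq rank_leq_col /=.
  pose E : 'M[C]_(k, 2 * n) := \matrix_(r, t) (t == r :> nat)%:R.
  have eE : \rank (E *m \matrix_(t < 2 * n, c < k) cell_point e z k t c) = k.
    rewrite (_ : E *m _ = 1%:M) ?mxrank1 //; apply/matrixP => r c; rewrite !mxE.
    have rn : (r < 2 * n)%N by have := ltn_ord r; lia.
    rewrite (bigD1 (Ordinal rn)) //= !mxE eqxx mul1r /cell_point /= ltn_ord big1 ?addr0 //.
    by move=> t; rewrite -val_eqE !mxE /= => /negPf ->; rewrite mul0r.
  by apply: leq_trans (mxrankM_maxr E _); rewrite eE.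
- rewrite (symp_pr13 (m := cell_point e z k)) //; last by move=> t c; rewrite mxE.
  rewrite big1 // => p _; rewrite big1 // => q _.
  by rewrite (iso k kn) ?mulr0.
have [Y YE] := inc k kn.
exists (\col_d \sum_(c < k) Y d c * x c 0).
apply/colP => t; rewrite !mxE eqSS.
transitivity (\sum_(c < k) (if t == k :> nat then 0 else cell_point e z k t c) * x c 0).
  case: ifP => _; first by rewrite big1 // => c _; rewrite mul0r.
  by apply: eq_bigr => c _; rewrite mxE.
transitivity (\sum_(c < k) \sum_(d < k.+1) cell_point e z k.+1 t d * (Y d c * x c 0)).
  by apply: eq_bigr => c _; rewrite YE // mulr_suml; apply: eq_bigr => d _; rewrite mulrA.
rewrite exchange_big; apply: eq_bigr => d _ /=.
by rewrite !mxE mulr_sumr.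
Qed.

Section Tableaux.
Variables (n : nat) (lam : seq nat).
Hypotheses (n0 : (0 < n)%N) (lamn : size lam = n).

Let L := lam1 lam.
Let kap j := mu lam j.+1.

Lemma mu_le j : (kap j <= n)%N.
Proof. by rewrite -lamn count_size. Qed.

Lemma mu_dec j : (kap j.+1 <= kap j)%N.
Proof. by apply: sub_count => x; apply: ltnW. Qed.

Lemma tabE_cell (T : tab n lam) r j : (r < n)%N -> (j < L)%N ->
  tabE T r.+1 j.+1 = (cell T j r).+1.
Proof.
move=> rn jL; rewrite /tabE /=.
by rewrite -[r]/(val (Ordinal rn)) -[j]/(val (Ordinal jL)) cellE !valK.
Qed.

Lemma XT_mon (T : tab n lam) A : XT T A = mon L kap (cell T) (entries A).
Proof.
rewrite /XT big_add1 /= big_mkord; apply: eq_bigr => j _.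
congr (\det _); apply/matrixP => r c; rewrite !mxE.
rewrite tabE_cell //; last by apply: leq_trans (mu_le j); rewrite /kap.
by rewrite /entries valK.
Qed.

Lemma all_iota1P m (p : pred nat) : reflect (forall r, (r < m)%N -> p r.+1) (all p (iota 1 m)).
Proof.
apply: (iffP allP) => [H r rm|H [|r]]; rewrite ?mem_iota //.
  by apply: H; rewrite mem_iota add1n ltnS.
by rewrite add1n ltnS => /andP[_]; apply: H.
Qed.

Lemma has_iota1P m (p : pred nat) : reflect (exists2 r, (r < m)%N & p r.+1) (has p (iota 1 m)).
Proof.
apply: (iffP hasP) => [[[|r]]|[r rm pr]]; rewrite ?mem_iota //.
  by rewrite add1n ltnS => /andP[_ rm] pr; exists r.
by exists r.+1; rewrite // mem_iota add1n ltnS.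
Qed.

Lemma SyST_P (T : tab n lam) : SyST T <-> tstdS (n := n) (N := 2 * n) kap T.
Proof.
have E i j (jL : (j < L)%N) (ik : (i < kap j)%N) : tabE T i.+1 j.+1 = (cell T j i).+1.
  by apply: tabE_cell => //; apply: leq_trans (mu_le j).
have TN i j : (cell T j i < 2 * n)%N by apply: cell_ltN; lia.
split.
  case/and5P => /forallP H0 /all_iota1P H1 /all_iota1P H2 /all_iota1P H3 /all_iota1P H4.
  have pT j : (j < L)%N -> pbw (kap j) (cell T j).
    move=> jL; split=> [r rk lt|r1 r2 /andP[r12 r2k] ne].
      have /all_iota1P/(_ r rk)/implyP := H1 j jL.
      by rewrite E // eqSS => /(_ lt)/eqP.
    have r1k := ltn_trans r12 r2k.
    have /all_iota1P/(_ r1 r1k)/all_iota1P/(_ r2 r2k)/implyP := H2 j jL.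
    by rewrite !E // eqSS !ltnS; apply; rewrite r12 andbT; apply/eqP.
  split; first split.
  - move=> r j kr; have := H0 (r, j); rewrite /= ltnNge kr /=.
    by move/eqP.
  - split=> // j jL r rk.
    have /implyP/(_ isT)/all_iota1P/(_ r rk)/has_iota1P[q qk] := H4 j.+1 jL.
    rewrite /= !E //; last exact: ltnW.
    by rewrite !ltnS => /andP[rq le]; exists q; rewrite ?rq.
  (* Failure of [admissible] yields an index [i] in its own row whose bar sits in a later row, which
     (iii) excludes. *)
  - move=> j jL; have [//|[i [r [/andP[ir rk] ei er]]]] := not_admissible (N := 2 * n) (pT j jL) (fun r _ => TN r j).
    exfalso; have ik := ltn_trans ir rk.
    have /all_iota1P/(_ i ik)/all_iota1P/(_ r rk)/implyP := H3 j jL.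
    have := mu_le j; rewrite /= !E // eqSS ei er eqxx /bar => kn.
    have -> : (((2 * n).-1 - i).+1 == (2 * n).+1 - i.+1)%N by lia.
    by move=> /(_ isT); lia.
move=> [[cT [pT ivT]] aT]; apply/and5P; split.
- apply/forallP => -[r j] /=; case: ltnP => //= kr; apply/eqP; exact: cT.
- apply/all_iota1P => j jL; apply/all_iota1P => r rk; apply/implyP.
  by rewrite E // eqSS => lt; have [f1 _] := pT j jL; rewrite f1.
- apply/all_iota1P => j jL; apply/all_iota1P => r1 r1k; apply/all_iota1P => r2 r2k; apply/implyP.
  rewrite !E // eqSS !ltnS => /andP[/eqP ne r12].
  by have [_ f2] := pT j jL; apply: f2; rewrite ?r12.
- apply/all_iota1P => j jL; apply/all_iota1P => i ik; apply/all_iota1P => r rk; apply/implyP.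
  rewrite !E // eqSS => /andP[/eqP ei /eqP er].
  have := aT j jL r rk; have := mu_le j; move: er; rewrite /bar.
  case: (eqVneq r i) => [->|/eqP]; first by rewrite ei; lia.
  lia.
- apply/all_iota1P => -[|j] jL; first by [].
  apply/implyP => _; apply/all_iota1P => r rk; apply/has_iota1P.
  have [q /andP[rq qk] le] := ivT j jL r rk.
  by exists q; rewrite //= !E ?ltnS ?rq //; apply: ltnW.
Qed.

End Tableaux.

(** * Independence and spanning *)

Lemma XT_cell_variety n lam (e : nat -> nat -> nat) z (T : tab n lam) :
    (0 < n)%N -> size lam = n ->
  XT T (fun k => \matrix_(t < 2 * n, c < k) cell_point e z k t c) =
  (mon_poly (lam1 lam) (fun j => mu lam j.+1) C e (cell T)).[z].
Proof.
move=> n0 lamn; rewrite XT_mon // -mon_cell_point; apply: eq_bigr => j _.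
congr (\det _); apply/matrixP => r c; rewrite !mxE.
have N0 : (0 < 2 * n)%N by lia.
rewrite -[cell T j r]/(val (Ordinal (cell_ltN N0 T j r))) entriesE mxE //.
Qed.

(** Elements of the component are treated as functions on the multi-cone [in_variety]; the monomials
    of arbitrary fillings [F] span it, so expanding each of them is enough for spanning. *)
Theorem theorem5p9 (n : nat) (lam : seq nat) :
  (0 < n)%N -> size lam = n -> sorted geq lam ->
  (forall c : tab n lam -> C,
      (forall A : forall k : nat, 'M[C]_(2 * n, k), in_variety A ->
          \sum_(T : tab n lam | SyST T) c T * XT T A = 0) ->
      forall T : tab n lam, SyST T -> c T = 0)
  /\
  (forall F : tab n lam, exists c : tab n lam -> C,
      forall A : forall k : nat, 'M[C]_(2 * n, k), in_variety A ->
          XT F A = \sum_(T : tab n lam | SyST T) c T * XT T A).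
Proof.
move=> n0 lamn _.
have N0 : (0 < 2 * n)%N by lia.
pose L := lam1 lam; pose kap j := mu lam j.+1.
have kapn j : (j < L)%N -> (kap j <= n)%N by move=> _; apply: mu_le.
have kapd j : (j.+1 < L)%N -> (kap j.+1 <= kap j)%N by move=> _; apply: mu_dec.
have stdP (T : tab n lam) : SyST T <-> tstdS kap T by apply: SyST_P.
split=> [c c0 T ST|F]; last first.
  have FN : inrange (2 * n) L kap (cell F) by move=> j _ r _; apply: cell_ltN.
  have [c cQ cE] := symplectic_straighten C_natr_neq0 (erefl (2 * n)%N) N0 kapn kapd FN.
  exists c => A VA; rewrite XT_mon // cE; last exact: entries_symplectic.
  rewrite [RHS]big_mkcond; apply: eq_bigr => T _; rewrite XT_mon //.
  case: ifP => // nST; have [->|/cQ/stdP] := eqVneq (c T) 0; first by rewrite mul0r.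
  by rewrite nST.
apply/eqP; apply: contraT => cT.
(* A relation is restricted to the symplectic curve of [wtS], where standard tableaux have distinct
   degrees; [c'] extends [c] by zero to all fillings. *)
pose e := wtS n (2 * n) L; pose p (T : tab n lam) := mon_poly L kap C e (cell T).
pose c' (T : tab n lam) := if SyST T then c T else 0.
have c'P U : c' U != 0 -> tstdS kap U.
  by rewrite /c'; case: ifP => [/stdP|]; rewrite ?eqxx.
have sz U : c' U != 0 -> size (p U) = (mon_deg L kap e (cell U)).+1.
  by move=> /c'P[sU _]; apply: size_wtS.
have sum0 : \sum_U c' U *: p U = 0.
  apply: (poly_eval_inj C_natr_neq0) => z; rewrite horner0 horner_sum.
  have VA := cell_variety (cell_point_symplectic (erefl (2 * n)%N) N0 L z).
  rewrite -[RHS](c0 _ VA) [RHS]big_mkcond; apply: eq_bigr => U _.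
  rewrite hornerZ /c'; case: ifP => _; last by rewrite mul0r.
  by rewrite XT_cell_variety.
have c'T : c' T != 0 by rewrite /c' ST.
have := @size_sum_distinct _ _ p c' _ _ T c'T; rewrite sum0 size_poly0 sz // ltn0.
apply=> [U /sz sU|U U' cU cU']; first by rewrite -size_poly_eq0 sU.
rewrite !sz // => -[]; apply: (tstdS_inj (erefl _) N0 kapn kapd); exact: c'P.
Qed.
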